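(* Let $\mathcal V$ be a finitely generated pseudovariety of minimal Taylor algebras and let, for each $\mathbf A\in\mathcal V$, two digraphs $as(\mathbf A)=(A;\rightarrow_{as})$ and $sm(\mathbf A)=(A;\rightarrow_{sm})$ be fixed so that the class $\{(\mathbf A,as(\mathbf A),sm(\mathbf A)):\mathbf A\in\mathcal V\}$ satisfies the Edge Axioms. Then for every $\mathbf A\in\mathcal V$ the digraph $asm(\mathbf A)=(A;\rightarrow_{as}\cup\rightarrow_{sm})$ is weakly connected.
   Context: All algebras are finite and idempotent. $\mathrm{Sg}(X)$ is the subuniverse generated by $X$ (a subuniverse is a subset closed under the operations). A Taylor term is an idempotent term satisfying a finite set of equations not satisfied by any projection on a set with more than one element. A finite algebra $\mathbf A$ is minimal Taylor if it has a Taylor term and each Taylor term operation of $\mathbf A$ generates the whole clone of term operations of $\mathbf A$. A finitely generated pseudovariety of minimal Taylor algebras is a class $\mathcal V=\mathsf{HSP}_{fin}(\mathbf A)$ (homomorphic images of subalgebras of finite powers) for a single finite minimal Taylor algebra $\mathbf A$; all its members are minimal Taylor. An algebra is affine if its clone of polynomial operations equals that of some left module over some ring with the same universe. A digraph is weakly connected if its underlying undirected graph is connected. **Edge Axioms** for a class assigning to each $\mathbf A\in\mathcal V$ digraphs $as(\mathbf A)=(A;\rightarrow_{as})$, $sm(\mathbf A)=(A;\rightarrow_{sm})$, where $\rightarrow_s:=\rightarrow_{as}\cap\rightarrow_{sm}$. For all $\mathbf A,\mathbf B,\mathbf C\in\mathcal V$: - Base 1: if $\mathbf B\le\mathbf A$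 is affine, then $a\rightarrow_{as}b$ in $\mathbf A$ for all $a,b\in B$. - Base 2: if $\mathbf B\le\mathbf A$ has a majority term, then $a\rightarrow_{sm}b$ in $\mathbf A$ for all $a,b\in B$. - Base 3: if $a,b\in A$ and some term $t(x,y)$ acts on $\{a,b\}$ as a semilattice operation with absorbing element $b$, then $a\rightarrow_s b$. - Homomorphism 1: if $f:\mathbf A\to\mathbf B$ is a homomorphism, $a\rightarrow_{as}b$ in $\mathbf A$ implies $f(a)\rightarrow_{as}f(b)$ in $\mathbf B$, and likewise for $\rightarrow_{sm}$. - Homomorphism 2: let $f:\mathbf A\to\mathbf B$ be a homomorphism, $a,b\in A$, and $x\in\{as,sm,s\}$. If $f(a)\rightarrow_x f(b)$ in $\mathbf B$, then $a\rightarrow_x b'$ in $\mathbf A$ for every $b'\in A$ such that $f(b')=f(b)$ and $\mathrm{Sg}(\{a,b'\})$ is minimal (under inclusion) among $\{\mathrm{Sg}(\{a,c\}):c\in A,\ f(c)=f(b)\}$. - Relational 1: if $R\le\mathbf A\times\mathbf B$, $a_1\rightarrow_{as}a_2$ in $\mathbf A$, $b_1\rightarrow_{sm}b_2$ in $\mathbf B$, and $(a_1,b_2),(a_2,b_1)\in R$, then $(a_2,b_2)\in R$. - Relational 2: if $R\le\mathbf A\times\mathbf B$, $a_1\rightarrow_{as}a_2$ in $\mathbf A$, $b_1\rightarrow_{as}b_2$ in $\mathbf B$, and $(a_1,b_1),(a_1,b_2),(a_2,b_1)\in R$, then $(a_2,b_2)\in R$. - Relational 3: if $R\le\mathbf A\times\mathbf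 B\times\mathbf C$, $a_1\rightarrow_{sm}a_2$ in $\mathbf A$, $b_1\rightarrow_{sm}b_2$ in $\mathbf B$, $c_1\rightarrow_{sm}c_2$ in $\mathbf C$, and $(a_1,b_2,c_2),(a_2,b_1,c_2),(a_2,b_2,c_1)\in R$, then $(a_2,b_2,c_2)\in R$. *)

(* Defs.v *)
From mathcomp Require Import all_boot ssralg.

Set Implicit Arguments.
Unset Strict Implicit.
Unset Printing Implicit Defensive.

(** * Signatures, terms and operations *)

Record signature := Signature { sym : Type; arity : sym -> nat }.

Definition operation (X : Type) (n : nat) := n.-tuple X -> X.

Definition interpretation (S : signature) (X : Type) :=
  forall o : sym S, operation X (arity o).

Inductive term (S : signature) (X : Type) :=
  | Var (x : X)
  | App (o : sym S) (ts : 'I_(arity o) -> term S X).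

Fixpoint eval (S : signature) (Y : Type) (I : interpretation S Y)
    (X : Type) (v : X -> Y) (t : term S X) : Y :=
  match t with
  | Var x => v x
  | App o ts => I o [tuple eval I v (ts i) | i < arity o]
  end.

Definition term_op S X (I : interpretation S X) n (f : operation X n) : Prop :=
  exists t : term S 'I_n, forall v : n.-tuple X, f v = eval I (tnth v) t.

(** A polynomial is a term whose leaves are variables or elements of [X]. *)
Definition poly_op S X (I : interpretation S X) n (f : operation X n) : Prop :=
  exists t : term S ('I_n + X), forall v : n.-tuple X,
    f v = eval I (fun z => match z with inl i => tnth v i | inr a => a end) t.

(** Clones consist of operations of positive arity. *)
Definition same_clone X (C D : forall n, operation X n -> Prop) : Prop :=
  forall n (f : operation X n), 0 < n -> C n f <-> D n f.

Definition op_sig (n : nat) : signature := @Signature unit (fun=> n).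

Definition op_interp X n (f : operation X n) : interpretation (op_sig n) X :=
  fun=> f.

(** * Taylor operations *)

Definition satisfies S X (I : interpretation S X) m k
    (E : 'I_k -> term S 'I_m * term S 'I_m) : Prop :=
  forall (j : 'I_k) (v : 'I_m -> X), eval I v (E j).1 = eval I v (E j).2.

Definition idempotent_op X n (f : operation X n) : Prop :=
  forall x, f (nseq_tuple n x) = x.

Definition projection X n (i : 'I_n) : operation X n := fun v => tnth v i.

Definition taylor_op X n (f : operation X n) : Prop :=
  idempotent_op f /\
  exists m k (E : 'I_k -> term (op_sig n) 'I_m * term (op_sig n) 'I_m),
    satisfies (op_interp f) E /\
    forall (Y : Type) (y1 y2 : Y), y1 <> y2 ->
      forall i : 'I_n, ~ satisfies (op_interp (@projection Y n i)) E.

(** * Finite algebras *)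

Record algebra (S : signature) := Algebra {
  carrier :> finType;
  interp : interpretation S carrier;
  carrier_gt0 : 0 < #|carrier|
}.

Arguments interp {S} A o _ : rename.

Definition idempotent_alg S (A : algebra S) : Prop :=
  forall o : sym S, idempotent_op (interp A o).

Definition minimal_taylor S (A : algebra S) : Prop :=
  (exists n (f : operation A n), term_op (interp A) f /\ taylor_op f) /\
  forall n (f : operation A n), term_op (interp A) f -> taylor_op f ->
    same_clone (@term_op _ _ (op_interp f)) (@term_op _ _ (interp A)).

Definition homomorphism S (A B : algebra S) (f : A -> B) : Prop :=
  forall (o : sym S) (v : (arity o).-tuple A),
    f (interp A o v) = interp B o (map_tuple f v).

Definition subuniverse S (A : algebra S) (B : {set A}) : Prop :=
  forall (o : sym S) (v : (arity o).-tuple A),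
    {subset v <= B} -> interp A o v \in B.

Definition Sg S (A : algebra S) (X : {set A}) (a : A) : Prop :=
  forall B : {set A}, subuniverse B -> X \subset B -> a \in B.

Record subalgebra S (A : algebra S) := Subalgebra {
  sub_set :> {set A};
  sub_closed : subuniverse sub_set;
  sub_neq0 : sub_set != set0
}.

Section Constructions.
Variable S : signature.

Section Sub.
Variables (A : algebra S) (B : subalgebra A).

Lemma sub_interp_subproof (o : sym S)
    (v : (arity o).-tuple {x : A | x \in sub_set B}) :
  interp A o (map_tuple val v) \in sub_set B.
Proof. by apply: sub_closed => _ /mapP[x _ ->]; exact: valP. Qed.

Definition sub_interp : interpretation S {x : A | x \in sub_set B} :=
  fun o v => exist (fun x => x \in sub_set B) _ (sub_interp_subproof v).

Lemma sub_gt0 : 0 < #|{: {x : A | x \in sub_set B}}|.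
Proof. by rewrite card_sig card_gt0 sub_neq0. Qed.

Definition sub_alg : algebra S := Algebra sub_interp sub_gt0.
End Sub.

Section Prod.
Variables A B : algebra S.

Definition prod_interp : interpretation S (A * B)%type :=
  fun o v => (interp A o (map_tuple fst v), interp B o (map_tuple snd v)).

Lemma prod_gt0 : 0 < #|{: A * B}|.
Proof. by rewrite card_prod muln_gt0 !carrier_gt0. Qed.

Definition prod_alg : algebra S := Algebra prod_interp prod_gt0.
End Prod.

Section Power.
Variables (A : algebra S) (n : nat).

Definition power_interp : interpretation S {ffun 'I_n -> A} :=
  fun o v => [ffun i => interp A o (map_tuple (fun g : {ffun 'I_n -> A} => g i) v)].

Lemma power_gt0 : 0 < #|{: {ffun 'I_n -> A}}|.
Proof. by rewrite card_ffun expn_gt0 carrier_gt0. Qed.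

Definition power_alg : algebra S := Algebra power_interp power_gt0.
End Power.

End Constructions.

Definition HSPfin S (M A : algebra S) : Prop :=
  exists n (R : subalgebra (power_alg M n)) (f : sub_alg R -> A),
    homomorphism f /\ forall a, exists r, f r = a.

Definition fg_minimal_taylor_pseudovariety S (V : algebra S -> Prop) : Prop :=
  exists M : algebra S,
    [/\ idempotent_alg M, minimal_taylor M & forall A, V A <-> HSPfin M A].

(** * Affine algebras, majority terms, semilattice operations *)

Section Module.
Local Open Scope ring_scope.

Inductive module_sym (R : Type) := MZero | MOpp | MAdd | MScale (r : R).

Definition module_sig (R : Type) : signature :=
  @Signature (module_sym R) (fun o =>
    match o with MZero => 0 | MOpp => 1 | MAdd => 2 | MScale _ => 1 end)%N.

Definition module_interp (R : pzRingType) (M : lmodType R) :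
    interpretation (module_sig R) M :=
  fun o => match o return operation M (@arity (module_sig R) o) with
  | MZero => fun _ => 0
  | MOpp => fun v => - tnth v ord0
  | MAdd => fun v => tnth v ord0 + tnth v ord_max
  | MScale r => fun v => r *: tnth v ord0
  end.
End Module.

Arguments module_interp {R} M o _.

(** [c] ranges over the left [R]-module structures on the type [A] itself. *)
Definition affine S (A : algebra S) : Prop :=
  exists (R : pzRingType) (c : GRing.Lmodule.axioms_ R A),
    same_clone (@poly_op _ _ (interp A))
               (@poly_op _ _ (module_interp (GRing.Lmodule.Pack c))).

Definition has_majority_term S (A : algebra S) : Prop :=
  exists2 m : operation A 3, term_op (interp A) m &
    forall x y : A, [/\ m [tuple x; x; y] = x,
                        m [tuple x; y; x] = x & m [tuple y; x; x] = x].

Definition semilattice_on (T : finType) (g : T -> T -> T) (B : {set T}) : Prop :=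
  [/\ {in B &, forall x y, g x y \in B},
      {in B, forall x, g x x = x},
      {in B &, forall x y, g x y = g y x} &
      {in B & &, forall x y z, g x (g y z) = g (g x y) z}].

Definition absorbing_on (T : finType) (g : T -> T -> T) (B : {set T}) (b : T) :
    Prop :=
  b \in B /\ {in B, forall x, g x b = b /\ g b x = b}.

(** * Edge axioms *)

(** An assignment of a digraph to every algebra; only its values on the class
    under consideration matter. *)
Definition edges (S : signature) := forall A : algebra S, rel A.

Section EdgeAxioms.
Variables (S : signature) (V : algebra S -> Prop) (eas esm : edges S).

Arguments eas A _ _ : clear implicits.
Arguments esm A _ _ : clear implicits.

Definition strong_edges : edges S := fun A a b => eas A a b && esm A a b.

Definition asm_edges : edges S := fun A a b => eas A a b || esm A a b.

Definition hom_axiom1 (e : edges S) : Prop :=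
  forall (A B : algebra S) (f : A -> B), V A -> V B -> homomorphism f ->
  forall a b : A, e A a b -> e B (f a) (f b).

Definition Sg_minimal (A B : algebra S) (f : A -> B) (a b b' : A) : Prop :=
  forall c : A, f c = f b ->
    (forall x, Sg [set a; c] x -> Sg [set a; b'] x) ->
    forall x, Sg [set a; b'] x -> Sg [set a; c] x.

Definition hom_axiom2 (e : edges S) : Prop :=
  forall (A B : algebra S) (f : A -> B), V A -> V B -> homomorphism f ->
  forall a b : A, e B (f a) (f b) ->
  forall b' : A, f b' = f b -> Sg_minimal f a b b' -> e A a b'.

Record edge_axioms : Prop := EdgeAxioms {
  base1 : forall (A : algebra S) (B : subalgebra A),
    V A -> V (sub_alg B) -> affine (sub_alg B) ->
    forall a b : A, a \in sub_set B -> b \in sub_set B -> eas A a b;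

  base2 : forall (A : algebra S) (B : subalgebra A),
    V A -> V (sub_alg B) -> has_majority_term (sub_alg B) ->
    forall a b : A, a \in sub_set B -> b \in sub_set B -> esm A a b;

  base3 : forall (A : algebra S) (a b : A), V A ->
    forall t : operation A 2, term_op (interp A) t ->
    semilattice_on (fun x y => t [tuple x; y]) [set a; b] ->
    absorbing_on (fun x y => t [tuple x; y]) [set a; b] b ->
    strong_edges a b;

  hom1_as : hom_axiom1 eas;
  hom1_sm : hom_axiom1 esm;

  hom2_as : hom_axiom2 eas;
  hom2_sm : hom_axiom2 esm;
  hom2_s : hom_axiom2 strong_edges;

  rel1 : forall (A B : algebra S) (R : subalgebra (prod_alg A B)),
    V A -> V B -> forall (a1 a2 : A) (b1 b2 : B),
    eas A a1 a2 -> esm B b1 b2 ->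
    (a1, b2) \in sub_set R -> (a2, b1) \in sub_set R ->
    (a2, b2) \in sub_set R;

  rel2 : forall (A B : algebra S) (R : subalgebra (prod_alg A B)),
    V A -> V B -> forall (a1 a2 : A) (b1 b2 : B),
    eas A a1 a2 -> eas B b1 b2 ->
    (a1, b1) \in sub_set R -> (a1, b2) \in sub_set R ->
    (a2, b1) \in sub_set R -> (a2, b2) \in sub_set R;

  rel3 : forall (A B C : algebra S)
      (R : subalgebra (prod_alg (prod_alg A B) C)),
    V A -> V B -> V C -> forall (a1 a2 : A) (b1 b2 : B) (c1 c2 : C),
    esm A a1 a2 -> esm B b1 b2 -> esm C c1 c2 ->
    (a1, b2, c2) \in sub_set R -> (a2, b1, c2) \in sub_set R ->
    (a2, b2, c1) \in sub_set R -> (a2, b2, c2) \in sub_set R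
}.

End EdgeAxioms.

Definition weakly_connected (T : finType) (e : rel T) : Prop :=
  forall x y : T, connect (fun u v => e u v || e v u) x y.

(* Main.v *)
From HB Require Import structures.
From mathcomp Require Import all_boot ssralg.
From mathcomp Require Import boolp.
Require Import Defs.

(** Take a disconnected algebra [A] of least size. By minimality and the lifting
    of edges along quotients, [A] is simple and each proper subuniverse lies in
    one connected component. Hence an invariant relation [R] from any algebra to
    [A] which is not functional has an element [x] with [R x = A]: otherwise all
    the sets [R x] lie in components, and linking them connects [A]. Applied to
    the relation generated by [(a, b)] and [(b, a)], for [a] and [b] in distinct
    components, this gives a semilattice operation on [{a, b}] (excluded) or an
    automorphism swapping [a] and [b]. Then either [A = {a, b}], and [A] has a
    majority term because one-in-three is not invariant under a Taylor term, or
    all subdirect nonfunctional binary relations are full. In the latter case,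
      if
    there is a compatible quasigroup then [A] is affine; otherwise relations
    with full binary projections are full, and [A] has a term which is majority
    on [{a, b}]. If no Taylor term (of the generator [M]) preserved [{a, b}],
      the
    terms preserving it would act as projections on some two-block quotient of a
    subset of [M], and so would every term on a subalgebra of [M], after
    correcting its values on [{a, b}]. By minimality of the clone [{a, b}] is
    then a subuniverse, so that [A = {a, b}] has a majority term. *)

Set Implicit Arguments.
Unset Strict Implicit.
Unset Printing Implicit Defensive.

Arguments Var {S X} x.

Lemma fin_choice (X Y : Type) (P : X -> Y -> Prop) :
  (forall x, exists y, P x y) -> exists f : X -> Y, forall x, P x (f x).
Proof. by case/choice=> f; exists f. Qed.

Lemma contra_ex (T : Type) (P : T -> Prop) :
  ~ (exists x, P x) -> forall x, ~ P x.
Proof. by move=> nP x Px; apply: nP; exists x. Qed.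

(** * Operations on functions and invariant relations *)

(** [ops] is [interpretation] with functions instead of tuples as arguments:
    powers then compute by conversion. *)
Definition ops (S : signature) (X : Type) :=
  forall o : sym S, ('I_(arity o) -> X) -> X.

Fixpoint tev S X (J : ops S X) Y (v : Y -> X) (t : term S Y) : X :=
  match t with
  | Var y => v y
  | App o ts => J o (fun i => tev J v (ts i))
  end.

Fixpoint tsub S X Y (s : X -> term S Y) (t : term S X) : term S Y :=
  match t with
  | Var x => s x
  | App o ts => App (fun i => tsub s (ts i))
  end.

Definition v2 X (x y : X) : bool -> X := fun b => if b then x else y.
Definition v3 X (x y z : X) : 'I_3 -> X := tnth [tuple x; y; z].

Section Ops.
Variable S : signature.

Definition idem X (J : ops S X) := forall o x, J o (fun=> x) = x.

Definition pow (I : Type) X (J : ops S X) : ops S (I -> X) :=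
  fun o u i => J o (fun j => u j i).

Definition inv1 X (J : ops S X) (P : X -> Prop) :=
  forall o u, (forall j, P (u j)) -> P (J o u).

Definition inv2 X Y (J : ops S X) (K : ops S Y) (R : X -> Y -> Prop) :=
  forall o u v, (forall j, R (u j) (v j)) -> R (J o u) (K o v).

Definition hom X Y (J : ops S X) (K : ops S Y) (f : X -> Y) :=
  forall o u, f (J o u) = K o (f \o u).

Lemma v3_comp X Y (f : X -> Y) x y z : f \o v3 x y z = v3 (f x) (f y) (f z).
Proof. by apply: funext; case=> [[|[|[|]]]]. Qed.

Lemma tev_sub X (J : ops S X) Y Z (v : Z -> X) (s : Y -> term S Z) t :
  tev J v (tsub s t) = tev J (fun y => tev J v (s y)) t.
Proof. by elim: t => //= o ts IH; congr (J _ _); apply: funext. Qed.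

Lemma tev_idem X (J : ops S X) Y x (t : term S Y) :
  idem J -> tev J (fun=> x) t = x.
Proof.
move=> iJ; elim: t => //= o ts IH; rewrite -[RHS](iJ o).
by congr (J _ _); apply: funext.
Qed.

Lemma tev_hom X Y (J : ops S X) (K : ops S Y) f Z (v : Z -> X) t :
  hom J K f -> f (tev J v t) = tev K (f \o v) t.
Proof.
by move=> hf; elim: t => //= o ts IH; rewrite hf; congr (K _ _); apply: funext.
Qed.

Lemma tev_pow (I : Type) X (J : ops S X) Z (v : Z -> I -> X) t i :
  tev (pow (I:=I) J) v t i = tev J (fun z => v z i) t.
Proof. by elim: t => //= o ts IH; congr (J _ _); apply: funext. Qed.

Lemma inv1_tev X (J : ops S X) (P : X -> Prop) Z (v : Z -> X) t :
  inv1 J P -> (forall z, P (v z)) -> P (tev J v t).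
Proof. by move=> iP Pv; elim: t => //= o ts IH; apply: iP. Qed.

Lemma inv2_tev X Y (J : ops S X) (K : ops S Y) R Z (v : Z -> X) (w : Z -> Y) t :
  inv2 J K R -> (forall z, R (v z) (w z)) -> R (tev J v t) (tev K w t).
Proof. by move=> iR Rv; elim: t => //= o ts IH; apply: iR. Qed.

Lemma inv1_gen X (J : ops S X) Z (v : Z -> X) :
  inv1 J (fun x => exists t, tev J v t = x).
Proof.
move=> o u /fin_choice[ts tsE]; exists (App ts) => /=.
by congr (J _ _); apply: funext.
Qed.

(** This is the subalgebra of the product generated by the pairs [(v z, w z)]; membership in it
    unfolds to a term with prescribed values on both sides. *)
Lemma inv2_gen X Y (J : ops S X) (K : ops S Y) Z (v : Z -> X) (w : Z -> Y) :
  inv2 J K (fun x y => exists t, tev J v t = x /\ tev K w t = y).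
Proof.
move=> o u u' /fin_choice[ts tsE]; exists (App ts) => /=.
by split; congr (_ _ _); apply: funext => j; case: (tsE j).
Qed.

Lemma inv2_sym X Y (J : ops S X) (K : ops S Y) R :
  inv2 J K R -> inv2 K J (fun y x => R x y).
Proof. by move=> iR o u v uv; apply: iR. Qed.

(** By idempotence [x] is the value of every operation at the constant tuple [x]. *)
Lemma inv2_section X Y (J : ops S X) (K : ops S Y) R x :
  idem J -> inv2 J K R -> inv1 K (R x).
Proof. by move=> iJ iR o u uR; rewrite -(iJ o x); apply: iR. Qed.

Lemma inv2_hom X X' Y Y' (J : ops S X) (J' : ops S X') (K : ops S Y)
    (K' : ops S Y') f g R :
  hom J' J f -> hom K' K g -> inv2 J K R ->
  inv2 J' K' (fun x y => R (f x) (g y)).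
Proof. by move=> hf hg iR o u v uv; rewrite hf hg; apply: iR. Qed.

Lemma inv2_comp X Y Z (J : ops S X) (K : ops S Y) (L : ops S Z) R Q :
  inv2 J K R -> inv2 K L Q -> inv2 J L (fun x z => exists y, R x y /\ Q y z).
Proof.
move=> iR iQ o u w /fin_choice[v Hv]; exists (K o v).
by split; [apply: iR | apply: iQ] => j; case: (Hv j).
Qed.

Lemma hom_id X (J : ops S X) : hom J J id. Proof. by []. Qed.

Lemma hom_comp X Y Z (J : ops S X) (K : ops S Y) (L : ops S Z) f g :
  hom J K f -> hom K L g -> hom J L (g \o f).
Proof. by move=> hf hg o u; rewrite /= hf hg. Qed.

Lemma inv1_eq X Y (J : ops S X) (K : ops S Y) f g :
  hom J K f -> hom J K g -> inv1 J (fun x => f x = g x).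
Proof. by move=> hf hg o u Pu; rewrite hf hg; congr (K _ _); apply: funext. Qed.

(** ** The congruence generated by a reflexive symmetric invariant relation *)

Fixpoint chain X (R : X -> X -> Prop) k x y :=
  if k is k'.+1 then exists z, R x z /\ chain R k' z y else x = y.

Section Chain.
Variables (X : Type) (J : ops S X) (R : X -> X -> Prop).
Arguments J : clear implicits.
Hypotheses (R_refl : forall x, R x x) (R_sym : forall x y, R x y -> R y x).
Hypothesis R_inv : inv2 J J R.

Lemma inv2_chain k : inv2 J J (chain R k).
Proof.
elim: k => [|k IH]; last exact: inv2_comp R_inv IH.
by move=> o u v uv /=; congr (J _ _); apply: funext.
Qed.

Lemma chain_leq k l x y : k <= l -> chain R k x y -> chain R l x y.
Proof.
elim: l k x => [|l IH] k x; first by rewrite leqn0 => /eqP->.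
rewrite leq_eqVlt => /predU1P[->//|kl] xy; exists x; split=> //.
exact: (IH k).
Qed.

Lemma chain_trans k l x y z :
  chain R k x y -> chain R l y z -> chain R (k + l) x z.
Proof.
elim: k x => [|k IH] x /=; first by move->.
by case=> w [xw wy] yz; exists w; split=> //; exact: IH.
Qed.

Lemma chain_sym k x y : chain R k x y -> chain R k y x.
Proof.
elim: k x y => [|k IH] x y; first by move=> /= ->.
case=> z [xz /IH zy]; rewrite -addn1; apply: chain_trans zy _.
by exists x; split=> //; exact: R_sym.
Qed.

Definition chains x y := exists k, chain R k x y.

(** Reflexivity pads the finitely many chains of the arguments to a common length. *)
Lemma inv2_chains : inv2 J J chains.
Proof.
move=> o u v /fin_choice[k Hk]; exists (\max_j k j); apply: inv2_chain => j.
exact: chain_leq (leq_bigmax j) (Hk j).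
Qed.

Lemma chains_min (E : X -> X -> Prop) :
  (forall x, E x x) -> (forall x y z, E x y -> E y z -> E x z) ->
  (forall x y, R x y -> E x y) -> forall x y, chains x y -> E x y.
Proof.
move=> Er Et RE x y [k]; elim: k x => [|k IH] x /=; first by move->.
by case=> z [/RE xz /IH]; exact: Et.
Qed.

End Chain.
End Ops.
Arguments pow {S I X} J o u i.
Arguments inv1_gen {S X} J {Z} v.
Arguments inv2_gen {S X Y} J K {Z} v w.

(** * Simple algebras with a partition isolating proper subuniverses *)

(** The properties of a disconnected algebra of least size; [E] is the
    equivalence whose classes are the connected components. *)
Record split_algebra S A (J : ops S A) (E : A -> A -> Prop) : Prop := {
  split_idem : idem J;
  splitxx : forall x, E x x;
  split_sym : forall x y, E x y -> E y x;
  split_trans : forall x y z, E x y -> E y z -> E x z;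
  split_gen : forall x y, ~ E x y -> forall P : A -> Prop,
    inv1 J P -> P x -> P y -> forall z, P z;
  split_simple : forall T : A -> A -> Prop,
    (forall x, T x x) -> (forall x y, T x y -> T y x) ->
    (forall x y z, T x y -> T y z -> T x z) -> inv2 J J T ->
    (forall x y, T x y -> x = y) \/ (forall x y, T x y);
  split_hom : forall f, hom J J f -> forall x y, E x y -> E (f x) (f y);
  split_semilattice : forall x y (t : term S bool),
    tev J (v2 x y) t = y -> tev J (v2 y x) t = y -> E x y;
  split_neq : exists x y, ~ E x y
}.

Section Split.
Variables (S : signature) (A : finType) (J : ops S A) (E : A -> A -> Prop).
Arguments J : clear implicits.
Hypothesis H : split_algebra J E.

Let iJ := split_idem H.
Let E_refl := splitxx H.
Let E_sym := split_sym H.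
Let E_trans := split_trans H.
Hint Resolve E_refl : core.

Lemma split_other x : exists y, ~ E x y.
Proof.
have [a [b nab]] := split_neq H.
have [xa|] := pselect (E x a); last by exists a.
by exists b => xb; apply: nab; apply: E_trans xb; apply: E_sym.
Qed.

Lemma split_not_both x a b : ~ E a b -> ~ E x a \/ ~ E x b.
Proof.
move=> nab; have [xa|] := pselect (E x a); last by left.
by right=> xb; apply: nab; apply: E_trans xb; apply: E_sym.
Qed.

Lemma split_neqx x y : ~ E x y -> x <> y.
Proof. by move=> nxy xy; apply: nxy; rewrite xy. Qed.

Lemma split_nsym x y : ~ E x y -> ~ E y x.
Proof. by move=> nxy /E_sym. Qed.

Lemma split_term x y z : ~ E x y -> exists t : term S bool,
  tev J (v2 x y) t = z.
Proof.
move=> nxy; apply: (split_gen H nxy (inv1_gen J (v2 x y))).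
  by exists (Var true).
by exists (Var false).
Qed.

(** Otherwise every [R x] lies in one class, and since by simplicity the
    relation "belonging to a common [R x]" connects everything, [E] is full. *)
Lemma full_section_family (X : Type) (R : X -> A -> Prop) :
  (forall x, inv1 J (R x)) ->
  inv2 J J (fun y z => exists x, R x y /\ R x z) ->
  (forall y, exists x, R x y) ->
  (exists x y z, [/\ R x y, R x z & y <> z]) ->
  exists x, forall y, R x y.
Proof.
move=> R1 R2 Ronto [x [y [z [xy xz nyz]]]]; apply: contrapT => /contra_ex nfull.
have RE u v : (exists x, R x u /\ R x v) -> E u v.
  case=> w [wu wv]; apply: contrapT => nuv; apply: (nfull w).
  exact: (split_gen H nuv (R1 w)).
set Q := fun _ _ => _ in R2.
have Qr u : Q u u by have [w wu] := Ronto u; exists w.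
have Qs u v : Q u v -> Q v u by case=> w [wu wv]; exists w.
have [a [b nab]] := split_neq H.
have [] := @split_simple _ _ _ _ H (chains Q).
- by move=> u; exists 0.
- by move=> u v [k uv]; exists k; exact: chain_sym.
- by move=> u v w [k uv] [l vw]; exists (k + l); exact: chain_trans uv vw.
- exact: inv2_chains.
- by move/(_ y z) => yz; apply: nyz; apply: yz; exists 1, z; split=> //;
  exists x.
- by move/(_ a b) => ab; apply: nab; exact: (chains_min E_refl E_trans RE).
Qed.

Lemma full_section (X : Type) (K : ops S X) (R : X -> A -> Prop) :
  idem K -> inv2 K J R -> (forall y, exists x, R x y) ->
  (exists x y z, [/\ R x y, R x z & y <> z]) ->
  exists x, forall y, R x y.
Proof.
move=> iK iR; apply: full_section_family => [x|].
  exact: inv2_section iK iR.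
exact: inv2_comp (inv2_sym iR) iR.
Qed.

Definition onto2 (X Y : Type) (R : X -> Y -> Prop) :=
  (forall x, exists y, R x y) /\ (forall y, exists x, R x y).

(** If some element has two partners, [full_section] gives an [x] related to everything. Any other
    element shares a partner with this [x], so the converse relation is not functional either and
    [full_section] applies to it too. *)
Lemma graph_or_centers R : inv2 J J R -> onto2 R ->
  (forall x y x' y', R x y -> R x' y' -> (x = x' <-> y = y')) \/
  (exists x, forall y, R x y) /\ (exists y, forall x, R x y).
Proof.
move=> iR [Rl Rr].
have [a [b /split_neqx ab]] := split_neq H.
have right : (exists x y z, [/\ R x y, R x z & y <> z]) ->
    exists x, forall y, R x y by exact: full_section.
have left : (exists y x z, [/\ R x y, R z y & x <> z]) ->
    exists y, forall x, R x y by exact: (full_section iJ (inv2_sym iR)).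
have [fR|nfR] := pselect (exists x y z, [/\ R x y, R x z & y <> z]).
  right; split; first exact: right.
  have [x xR] := right fR; apply: left.
  have [z zx] : exists z, z <> x.
    by have [z /split_neqx zx] := split_other x; exists z => /esym.
  by have [y zy] := Rl z; exists y, x, z; split=> // /esym.
have [fL|nfL] := pselect (exists y x z, [/\ R x y, R z y & x <> z]).
  case: nfR; have [y yR] := left fL.
  have [z /split_neqx yz] := split_other y.
  by have [x xz] := Rr z; exists x, y, z.
left=> x y x' y' xy xy'; split=> [xx|yy]; apply: contrapT => neq.
  by apply: nfR; exists x, y, y'; rewrite {2}xx.
by apply: nfL; exists y, x, x'; rewrite {2}yy.
Qed.

Lemma onto2_pairs (R : A -> A -> Prop) a b c d : inv2 J J R -> ~ E a b ->
  ~ E c d -> R a c -> R b d -> onto2 R.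
Proof.
move=> iR ab cd ac bd; split=> [x|y].
  have [t <-] := split_term x ab; exists (tev J (v2 c d) t).
  by apply: inv2_tev => //; case.
have [t <-] := split_term y cd; exists (tev J (v2 a b) t).
by apply: inv2_tev => //; case.
Qed.

(** ** Automorphisms *)

Lemma hom_agree f g a b : hom J J f -> hom J J g -> ~ E a b ->
  f a = g a -> f b = g b -> f =1 g.
Proof. by move=> hf hg ab; apply: (split_gen H ab); exact: inv1_eq. Qed.

(** The relation generated by [(a, b)] and [(b, a)] is either the graph of the automorphism or has
    an element [c] to which everything is related. In the second case [split_semilattice] excludes
    the pairs [(a, a)] and [(b, b)], but one of them is generated unless [c] is equivalent to both
    [a] and [b]. *)
Lemma split_swap a b : ~ E a b ->
  exists s, [/\ hom J J s, s a = b, s b = a & involutive s].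
Proof.
move=> ab; have ba := split_nsym ab.
pose R x y := exists t, tev J (v2 a b) t = x /\ tev J (v2 b a) t = y.
have iR : inv2 J J R by exact: inv2_gen.
have Rab : R a b by exists (Var true).
have Rba : R b a by exists (Var false).
have oR : onto2 R := onto2_pairs iR ab ba Rab Rba.
have [fR|[_ [c cR]]] := graph_or_centers iR oR.
  have [s sR] := fin_choice oR.1.
  have sE x y : R x y -> s x = y by move=> xy; apply/(fR _ _ _ _ (sR x) xy).
  have hs : hom J J s by move=> o u; apply: sE; apply: iR => j; exact: sR.
  exists s; split=> //; try exact: sE.
  apply: (@hom_agree (s \o s) id a b) => //=; first exact: (hom_comp hs hs).
    by rewrite (sE _ _ Rab) (sE _ _ Rba).
  by rewrite (sE _ _ Rba) (sE _ _ Rab).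
have nRaa : ~ R a a.
  case=> t [ta tb]; apply: ba; exact: (@split_semilattice _ _ _ _ H _ _ t).
have nRbb : ~ R b b.
  case=> t [ta tb]; apply: ab; exact: (@split_semilattice _ _ _ _ H _ _ t).
case: ab; apply: (@E_trans _ c); apply: contrapT => nE.
  by apply: nRbb; apply: (split_gen H nE (inv2_section iJ iR)).
apply: nRaa; apply: (split_gen H (split_nsym nE) (inv2_section iJ iR)) => //.
Qed.

(** Inside one class, two swaps are composed through an element of another class. *)
Lemma split_transitive b d : exists f g, [/\ hom J J f, cancel g f & f b = d].
Proof.
have [bd|nbd] := pselect (E b d); last first.
  by have [s [hs sb _ sK]] := split_swap nbd; exists s, s.
have [a nba] := split_other b.
have nad : ~ E a d by move/E_sym => da; apply: nba; exact: E_trans da.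
have [s [hs sb _ sK]] := split_swap nba.
have [s' [hs' sa _ sK']] := split_swap nad.
exists (s' \o s), (s \o s'); split; last by rewrite /= sb.
  exact: (hom_comp hs hs').
by move=> x /=; rewrite sK sK'.
Qed.

(** ** Invariant binary relations *)

(** If [R] is not full, then its two centers form a partition of [A] into the
    class of [a] and that of [b], so [E] is a congruence, hence trivial. *)
Lemma order_or_full a b (R : A -> A -> Prop) : ~ E a b ->
  inv2 J J R -> R a a -> R b b -> R a b -> ~ R b a ->
  forall x, x = a \/ x = b.
Proof.
move=> ab iR aa bb ab' nba.
have Rr x : R x x.
  by apply: (split_gen H ab (P := fun x => R x x)) => // o u; exact: iR.
have iRr x := inv2_section iJ iR (x := x).
have iRl x := inv2_section iJ (inv2_sym iR) (x := x).
have aR : forall x, R a x by exact: (split_gen H ab (iRr a)).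
have Rb : forall x, R x b by exact: (split_gen H ab (iRl b)).
have C1 x : ~ E x b -> forall y, R x y.
  by move=> xb; apply: (split_gen H xb (iRr x)).
have C2 x : ~ E x a -> forall y, R y x.
  by move=> xa; apply: (split_gen H xa (iRl x)).
have nC1 x : ~ E x a -> ~ R x a.
  by move=> xa Rxa; apply: nba; exact: (split_gen H xa (iRl a)).
have Eab x : E x a -> ~ E x b.
  by move=> xa xb; apply: ab; apply: E_trans xb; exact: E_sym.
have nT x y : E x a -> ~ E y a -> ~ R y x.
  move=> xa ya yx; apply: (nC1 _ ya); have yx' : ~ E y x.
    by move=> yEx; apply: ya; exact: E_trans xa.
  exact: (split_gen H yx' (iRr y)).
(* The intersection of [R] with its converse is thus the equivalence whose blocks are the class of
   [a] and its complement; simplicity applies to it. *)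
have TE x y : (R x y /\ R y x) <-> (E x a <-> E y a).
  split=> [[xy yx]|xay].
    by split=> za; apply: contrapT => nz; [apply: (nT x y) | apply: (nT y x)].
  have [xa|xa] := pselect (E x a).
    by split; apply: C1; apply: Eab => //; apply/xay.
  by split; apply: C2 => // /xay.
have nEba : ~ E b a by exact: split_nsym.
have [] := @split_simple _ _ _ _ H (fun x y => R x y /\ R y x).
- by move=> x; split.
- by move=> x y [].
- by move=> x y z /TE xy /TE yz; apply/TE; rewrite xy.
- by move=> o u v uv; split; apply: iR => j; case: (uv j).
- move=> eqT x; have [xa|xa] := pselect (E x a).
    by left; apply: eqT; apply/TE; split.
  by right; apply: eqT; apply/TE; split.
- by move/(_ a b) => [].
Qed.

(** By [order_or_full], a failure of this property forces the algebra to be [{a, b}]; that case is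
    left to [two_element]. *)
Definition full_orders := forall a b (R : A -> A -> Prop), ~ E a b ->
  inv2 J J R -> R a a -> R b b -> R a b -> R b a.

Hypothesis full : full_orders.

(** Not being a graph, [R] has a left center [a] and a right center [d]. An automorphism sending
    some [b] far from [a] to [d] turns [R] into a relation containing [(a, a)], [(b, b)] and
    [(a, b)], hence [(b, a)]; these four pairs generate everything. *)
Lemma linked_full (R : A -> A -> Prop) : inv2 J J R -> onto2 R ->
  (exists x y z, [/\ R x y, R x z & y <> z]) -> forall x y, R x y.
Proof.
move=> iR oR nR.
have [gR|[[a aR] [d Rd]]] := graph_or_centers iR oR.
  by case: nR => x [y [z [xy xz []]]]; apply/(gR _ _ _ _ xy xz).
have [b ab] := split_other a.
have [f [g [hf gf fb]]] := split_transitive b d.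
have iR' : inv2 J J (fun x y => R x (f y)) by exact: inv2_hom hf iR.
have bfa : R b (f a) by apply: (full ab iR'); rewrite ?fb.
have bR : forall y, R b (f y).
  by apply: (split_gen H ab (inv2_section iJ iR' (x := b))); rewrite ?fb.
have iRl y := inv2_section iJ (inv2_sym iR') (x := y).
by move=> x y; rewrite -(gf y); apply: (split_gen H ab (iRl (g y))).
Qed.
End Split.

(** * Two-element algebras and the one-in-three relation *)

(** The Boolean functions preserving one-in-three are the projections. The hypothesis makes [F]
    false at the empty set, compatible with complements and additive on disjoint unions, so it is a
    principal ultrafilter. *)
Lemma principal_family (X : finType) (F : {set X} -> bool) :
  (forall p : X -> 'I_3, \sum_(k < 3) F [set i | p i == k] = 1) ->
  exists i, forall B, F B = (i \in B).
Proof.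
move=> F3.
have F0 : F set0 = false.
  have := F3 (fun=> ord0); rewrite !big_ord_recl big_ord0.
  rewrite (_ : finset _ = setT); last by apply/setP=> i; rewrite !inE eqxx.
  rewrite (_ : finset _ = set0); last by apply/setP=> i; rewrite !inE.
  by case: (F set0); case: (F _).
have F2 B : F (~: B) = ~~ F B.
  have := F3 (fun i => inord (i \notin B)); rewrite !big_ord_recl big_ord0.
  rewrite (_ : finset _ = B); last first.
    by apply/setP=> i; rewrite !inE -val_eqE /= inordK; case: (i \in B).
  rewrite (_ : finset _ = ~: B); last first.
    by apply/setP=> i; rewrite !inE -val_eqE /= inordK; case: (i \in B).
  rewrite (_ : finset _ = set0); last first.
    by apply/setP=> i; rewrite !inE -val_eqE /= inordK; case: (i \in B).
  by rewrite F0; case: (F B); case: (F _).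
have FU (B C : {set X}) : [disjoint B & C] -> F (B :|: C) = F B || F C.
  move=> /pred0P dBC.
  pose p i : 'I_3 := inord (if i \in B then 0 else if i \in C then 1 else 2).
  have := F3 p; rewrite !big_ord_recl big_ord0.
  rewrite (_ : finset _ = B); last first.
    apply/setP=> i; rewrite !inE -val_eqE /= inordK; last by case: (i \in B);
      case: (i \in C).
    by case: (i \in B); case: (i \in C).
  rewrite (_ : finset _ = C); last first.
    apply/setP=> i; rewrite !inE -val_eqE /= inordK; last by case: (i \in B);
      case: (i \in C).
    by move: (dBC i) => /=; case: (i \in B); case: (i \in C).
  rewrite (_ : finset _ = ~: (B :|: C)); last first.
    apply/setP=> i; rewrite !inE -val_eqE /= inordK; last by case: (i \in B);
      case: (i \in C).
    by case: (i \in B); case: (i \in C).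
  by rewrite F2; case: (F B); case: (F C); case: (F _).
have FD (B : {set X}) i : i \in B -> F B = F [set i] || F (B :\ i).
  move=> iB; rewrite -FU; first by rewrite setD1K.
  by rewrite disjoints1 !inE eqxx.
have Fpt B : F B -> exists i, F [set i].
  elim: {B}_.+1 {-2}B (ltnSn #|B|) => // n IH B leBn FB.
  have [B0|[i iB]] := set_0Vmem B; first by rewrite B0 F0 in FB.
  have [Fi|nFi] := boolP (F [set i]); first by exists i.
  apply: (IH (B :\ i)); first by move: leBn; rewrite (cardsD1 i B) iB.
  by move: FB; rewrite (FD B i iB) (negPf nFi).
have [i Fi] : exists i, F [set i] by apply: (Fpt setT); rewrite -setC0 F2 F0.
have Fin (B : {set X}) : i \in B -> F B.
  by move=> iB; rewrite (FD B i iB) Fi.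
exists i => B; have [iB|niB] := boolP (i \in B); first exact: Fin.
by apply/negbTE; rewrite -F2; apply: Fin; rewrite inE.
Qed.

Section TwoElement.
Variables (S : signature) (A : finType) (J : ops S A) (E : A -> A -> Prop).
Arguments J : clear implicits.
Hypothesis H : split_algebra J E.

(** The automorphism exchanging [a] and [b] carries the three values at [a] to those at [b]. *)
Lemma majority_pair a b (t : term S 'I_3) : ~ E a b ->
  (forall x, x = a \/ x = b) ->
  [/\ tev J (v3 a a b) t = a, tev J (v3 a b a) t = a
    & tev J (v3 b a a) t = a] ->
  forall x y, [/\ tev J (v3 x x y) t = x, tev J (v3 x y x) t = x
    & tev J (v3 y x x) t = x].
Proof.
move=> ab Aab [t1 t2 t3] x y; have [s [hs sa sb sK]] := split_swap H ab.
have vxx c : v3 c c c = fun=> c :> A by apply: funext => -[[|[|[|]]]].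
have [u1 u2 u3] : [/\ tev J (v3 b b a) t = b, tev J (v3 b a b) t = b
    & tev J (v3 a b b) t = b].
  rewrite -{1 2 4 5 7 8}sa -{3 5 7}sb -!v3_comp -!(tev_hom _ _ hs).
  by rewrite t1 t2 t3 sa.
have iJ := split_idem H.
by case: (Aab x) => ->; case: (Aab y) => ->; split; rewrite ?vxx ?tev_idem.
Qed.

(** When no term is a majority, all terms preserve one-in-three: [R] twisted by the swap forbids two
    values [b], and three values [a] would give a majority. So [principal_family] makes every term a
    projection. *)
Lemma two_element a b (R : A -> A -> Prop) : ~ E a b ->
  (forall x, x = a \/ x = b) ->
  inv2 J J R -> R a a -> R b b -> R a b -> ~ R b a ->
  (exists t : term S 'I_3, forall x y,
    [/\ tev J (v3 x x y) t = x, tev J (v3 x y x) t = x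
      & tev J (v3 y x x) t = x]) \/
  (forall (X : finType) (t : term S X), exists i, forall v, tev J v t = v i).
Proof.
move=> ab Aab iR Raa Rbb Rab nRba.
have iJ := split_idem H.
have [s [hs sa sb sK]] := split_swap H ab.
have [[t tP]|nm] := pselect (exists t : term S 'I_3,
    [/\ tev J (v3 a a b) t = a, tev J (v3 a b a) t = a
      & tev J (v3 b a a) t = a]).
  by left; exists t; exact: majority_pair tP.
right=> X t.
have ba : b != a by apply/eqP => ba; apply: ab; rewrite ba; exact: splitxx H _.
pose F (B : {set X}) := tev J (fun i => if i \in B then b else a) t == b.
pose w (k j : 'I_3) := if j == k then b else a.
have wE (k : 'I_3) : w k = tnth [tuple v3 b a a; v3 a b a; v3 a a b] k.
  by apply: funext; case: k => [[|[|[|]]]] // ?; case=> [[|[|[|]]]].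
(* The only pair missing from the twisted relation is [(b, b)], and two distinct rows [w k], [w l]
   never have [b] in the same place. *)
have Rw (u : term S 'I_3) k l : k != l -> R (tev J (w k) u) (s (tev J (w l) u)).
  move=> kl; apply: (@inv2_tev _ _ _ J J (fun x y => R x (s y))) => [|j].
    exact: inv2_hom (@hom_id _ _ J) hs iR.
  rewrite /w; case: eqP => [->|_]; first by rewrite (negPf kl) sa.
  by case: eqP => _; rewrite ?sa ?sb.
have [|i iF] := @principal_family X F.
  move=> p; pose u := tsub (fun i => Var (p i)) t.
  have FE k : F [set i | p i == k] = (tev J (w k) u == b).
    by rewrite tev_sub /F; congr (tev _ _ _ == _); apply: funext => i;
      rewrite inE.
  have ab2 k : (tev J (w k) u == b) = ~~ (tev J (w k) u == a).
    by case: (Aab (tev J (w k) u)) => ->;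
      rewrite eqxx ?(negPf ba) // eq_sym (negPf ba).
  have once k l : k != l -> ~~ ((tev J (w k) u == b) && (tev J (w l) u == b)).
    move=> kl; apply/negP => /andP[/eqP xb /eqP yb].
    by have := Rw u _ _ kl; rewrite xb yb sb => /nRba.
  rewrite !big_ord_recl big_ord0 !FE.
  have := once ord0 (lift ord0 ord0) isT.
  have := once ord0 (lift ord0 (lift ord0 ord0)) isT.
  have := once (lift ord0 ord0) (lift ord0 (lift ord0 ord0)) isT.
  have : ~~ [&& tev J (w ord0) u == a, tev J (w (lift ord0 ord0)) u == a
           & tev J (w (lift ord0 (lift ord0 ord0))) u == a].
    apply/and3P => -[/eqP t3 /eqP t2 /eqP t1]; apply: nm; exists u.
    by move: t1 t2 t3; rewrite !wE.
  rewrite !ab2; do 3 case: (_ == a) => //.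
exists i => v; have := iF [set j | v j == b]; rewrite inE /F.
rewrite (_ : (fun j => _) = v).
  case: (Aab (tev J v t)) => ->; case: (Aab (v i)) => ->; rewrite ?eqxx //.
    by rewrite eq_sym (negPf ba).
  by rewrite (eq_sym a) (negPf ba).
apply: funext => j; rewrite inE; case: eqP => //.
by case: (Aab (v j)).
Qed.
End TwoElement.
(** ** Invariant relations of higher arity *)

Definition upd (X : eqType) A (w : X -> A) s d x := if x == s then d else w x.

Lemma upd_id (X : eqType) A (w : X -> A) s : upd w s (w s) = w.
Proof. by apply: funext => x; rewrite /upd; case: eqP => [->|]. Qed.

Lemma updd (X : eqType) A (w : X -> A) s d : upd w s d s = d.
Proof. by rewrite /upd eqxx. Qed.

Lemma updN (X : eqType) A (w : X -> A) s d x : x != s -> upd w s d x = w x.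
Proof. by rewrite /upd => /negPf->. Qed.

Lemma updC (X : eqType) A (w : X -> A) s t d e : s != t ->
  upd (upd w s d) t e = upd (upd w t e) s d.
Proof.
move=> st; apply: funext => x; rewrite /upd; case: eqP => // ->.
by rewrite eq_sym (negPf st).
Qed.

Lemma hom_upd S (X : eqType) A (J : ops S A) (w : X -> A) s :
  idem J -> hom J (pow J) (upd w s).
Proof.
move=> iJ o u; apply: funext => x; rewrite /pow /upd /=.
by case: eqP => // _; rewrite iJ.
Qed.

Section Linked.
Variables (S : signature) (A : finType) (J : ops S A) (E : A -> A -> Prop).
Arguments J : clear implicits.
Hypothesis H : split_algebra J E.
Hypothesis full : full_orders J E.

Let iJ := split_idem H.

(** Induction on the number of coordinates where the tuple differs from [w]. Freeing one of these
    coordinates gives a binary relation with a full section at [w s], which [linked_full] makes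
    full. *)
Lemma propagate (X : finType) (B : (X -> A) -> A -> Prop) :
  inv2 (pow J) J B -> (forall w, exists c, B w c) ->
  (exists w, forall c, B w c) -> forall w c, B w c.
Proof.
move=> iB Bl [w wB] w'.
have [n] := ubnP #|[set x | w' x != w x]|; elim: n w' => // n IH w' le_n.
have [w0|[s]] := set_0Vmem [set x | w' x != w x].
  move=> c; rewrite (_ : w' = w) //; apply: funext => x; apply/eqP.
  by move/setP/(_ x): w0; rewrite !inE => /negbFE.
rewrite inE => ws.
pose R d c := B (upd w' s d) c.
have iR : inv2 J J R := inv2_hom (hom_upd w' s iJ) (hom_id J) iB.
have wsR c : R (w s) c.
  apply: IH; rewrite -ltnS; apply: leq_trans le_n; rewrite ltnS.
  apply: proper_card; apply/properP; split; last first.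
    by exists s; rewrite !inE // updd eqxx.
  apply/subsetP=> x; rewrite !inE /upd; case: (x =P s) => // ->.
  by rewrite eqxx.
have [y yws] : exists y, w s <> y.
  by have [y /(split_neqx H)] := split_other H (w s); exists y.
have : forall x y, R x y.
  apply: (linked_full H full iR); last by exists (w s), (w s), y.
  by split=> [x|y']; [apply: Bl | exists (w s)].
by move=> R_full c; have := R_full (w' s) c; rewrite /R upd_id.
Qed.

(** Induction on the number of coordinates different from [z]. Freeing two of them gives a binary
    relation that contains the cross through [z], so it is linked and full. *)
Lemma axes_full (z : A) (X : finType) (M : (X -> A) -> Prop) : 0 < #|X| ->
  inv1 (pow J) M ->
  (forall s g, (forall x, x != s -> g x = z) -> M g) -> forall g, M g.
Proof.
move=> /card_gt0P[x0 _] iM Maxes g.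
have [n] := ubnP #|[set x | g x != z]|; elim: n g => // n IH g le_n.
have [|[s]] := set_0Vmem [set x | g x != z].
  move/setP=> g0; apply: (Maxes x0) => x _; apply/eqP.
  by have := g0 x; rewrite !inE => /negbFE.
rewrite inE => gs.
have [|[t]] := set_0Vmem [set x | (g x != z) && (x != s)].
  move/setP=> g0; apply: (Maxes s) => x xs; apply/eqP.
  by have := g0 x; rewrite !inE xs andbT => /negbFE.
rewrite inE => /andP[gt ts].
have IHs r g' : g r != z -> g' r = z -> (forall x, g x = z -> g' x = z) -> M g'.
  move=> gr g'r g'0; apply: IH; rewrite -ltnS; apply: leq_trans le_n.
  rewrite ltnS; apply: proper_card; apply/properP; split; last first.
    by exists r; rewrite !inE // g'r eqxx.
  by apply/subsetP=> x; rewrite !inE; apply: contra => /eqP/g'0->.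
pose h c d := upd (upd g s c) t d.
pose R c d := M (h c d).
have iR : inv2 J J R.
  move=> o u v uv; rewrite /R (_ : h _ _ = pow J o (fun j => h (u j) (v j))).
    exact: iM.
  apply: funext => x; rewrite /h /upd /pow.
  by case: eqP => // _; case: eqP => // _; rewrite iJ.
have Rcz c : R c z.
  apply: (IHs t) => //; first by rewrite /h updd.
  move=> x gx; rewrite /h /upd; case: eqP => // _; case: (x =P s) => // xs.
  by rewrite -xs gx eqxx in gs.
have Rzd d : R z d.
  apply: (IHs s) => //; first by rewrite /h updN 1?eq_sym // updd.
  move=> x gx; rewrite /h /upd; case: (x =P t) => [xt|_]; last by case: eqP.
  by rewrite -xt gx eqxx in gt.
have /(_ (g s) (g t)) : forall c d, R c d.
  apply: (linked_full H full iR); first by split=> c; exists z.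
  by exists z, z, (g t); split=> //; apply/eqP; rewrite eq_sym.
by rewrite /R /h upd_id upd_id.
Qed.

End Linked.
(** ** Compatible quasigroups *)

Section Quasigroup.
Variables (S : signature) (A : finType) (J : ops S A) (E : A -> A -> Prop).
Arguments J : clear implicits.
Hypothesis H : split_algebra J E.
Hypothesis full : full_orders J E.

Let iJ := split_idem H.

Definition hom2 (f : A -> A -> A) :=
  forall o u v, f (J o u) (J o v) = J o (fun j => f (u j) (v j)).

Definition latin f :=
  [/\ hom2 f, forall x, injective (f x) & forall y, injective (f^~ y)].

Record compatible_group (add : A -> A -> A) (z : A) (opp : A -> A) : Prop := {
  cg_hom : hom2 add;
  cg_assoc : associative add;
  cg_comm : commutative add;
  cg_add0 : left_id z add;
  cg_addN : left_inverse z opp add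
}.

Lemma hom2_l f y : hom2 f -> hom J J (f^~ y).
Proof. by move=> hf o u; rewrite -[in LHS](iJ o y) hf. Qed.

Lemma hom2_r f x : hom2 f -> hom J J (f x).
Proof. by move=> hf o u; rewrite -[in LHS](iJ o x) hf. Qed.

Lemma hom2_comp f g h k : hom2 f -> hom J J g -> hom J J h -> hom J J k ->
  hom2 (fun x y => k (f (g x) (h y))).
Proof. by move=> hf hg hh hk o u v; rewrite hg hh hf hk. Qed.

(** The equalizer of [f] and [g] is invariant and contains the cross through [z], hence is
    linked. *)
Lemma hom2_axes z f g : hom2 f -> hom2 g ->
  (forall x, f x z = g x z) -> (forall y, f z y = g z y) ->
  forall x y, f x y = g x y.
Proof.
move=> hf hg fg1 fg2.
apply: (linked_full H full (R := fun x y => f x y = g x y)).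
- by move=> o u v uv; rewrite hf hg; congr (J _ _); apply: funext.
- by split=> c; exists z.
- by have [y /(split_neqx H)] := split_other H z; exists z, z, y.
Qed.

Lemma hom_inverse f g : hom J J f -> cancel f g -> cancel g f -> hom J J g.
Proof.
move=> hf fg gf o u; rewrite -[RHS]fg hf; congr (g (J _ _)).
by apply: funext => j /=; rewrite gf.
Qed.

(** The isotope [add] of the quasigroup has the neutral element [f e e]. Both sides of commutativity
    and of associativity are compatible operations that agree on the axes, so [hom2_axes] identifies
    them, as in the Eckmann-Hilton argument. *)
Lemma latin_group f : latin f -> exists add z opp, compatible_group add z opp.
Proof.
move=> [hf fr fl]; have [e _] := split_neq H.
have [l l1 l2] := injF_bij (fl e); have [r r1 r2] := injF_bij (fr e).
have hl := hom_inverse (hom2_l e hf) l1 l2.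
have hr := hom_inverse (hom2_r e hf) r1 r2.
pose add x y := f (l x) (r y); pose z := f e e.
have ha : hom2 add by apply: (hom2_comp hf hl hr (hom_id J)).
have addz x : add x z = x by rewrite /add /z r1 l2.
have zadd x : add z x = x by rewrite /add /z l1 r2.
have addC : commutative add.
  by apply: (hom2_axes (z := z)) => [||x|x]; rewrite ?addz ?zadd.
have addA : associative add.
  move=> x y w; move: x y; apply: (hom2_axes (z := z)) => [||x|y].
  - exact: (hom2_comp ha (hom_id J) (hom2_l w ha) (hom_id J)).
  - exact: (hom2_comp ha (hom_id J) (hom_id J) (hom2_l w ha)).
  - by rewrite zadd addz.
  - by rewrite !zadd.
have addI : injective (add^~ z) by move=> x y; rewrite !addz.
have invr y : exists x, add x y = z.
  have inj : injective (add^~ y).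
    by move=> x x' /fl/(congr1 (f^~ e)); rewrite !l2.
  by have [g _ g2] := injF_bij inj; exists (g z).
have [opp oppP] := fin_choice invr.
by exists add, z, opp; split.
Qed.

Section Group.
Variables (add : A -> A -> A) (z : A) (opp : A -> A).
Hypothesis G : compatible_group add z opp.

Let addC := cg_comm G.
Let addA := cg_assoc G.
Let add0 := cg_add0 G.
Let addN := cg_addN G.

Lemma cgI x : injective (add^~ x).
Proof.
move=> y y' /(congr1 (add^~ (opp x))) /=.
by rewrite -!addA ![add x _]addC addN ![add _ z]addC !add0.
Qed.

Lemma tev_add X (u v : X -> A) t :
  tev J (fun x => add (u x) (v x)) t = add (tev J u t) (tev J v t).
Proof.
elim: t => //= o ts IH; rewrite (cg_hom G); congr (J _ _).
by apply: funext.
Qed.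

(** Take a maximal set [K] of elements far from [z] on which binary terms at [(x, z)] realize all
    functions. Independence gives the term [d] on [K], and maximality transfers its identities to
    all far elements. *)
Lemma far_axes_term : exists d : term S 'I_3, forall x, ~ E z x ->
  tev J (v3 x z z) d = x /\ tev J (v3 z z x) d = x.
Proof.
pose fullon (K : {set A}) := forall w : A -> A, exists t : term S bool,
  forall x, x \in K -> tev J (v2 x z) t = w x.
pose P := [pred K : {set A} |
  `[< (forall x, x \in K -> ~ E z x) /\ fullon K >]].
have [|K /maxsetP[/asboolP[KN fK] Kmax]] := @ex_maxset _ P.
  exists set0; apply/asboolP; split=> [x|w]; first by rewrite inE.
  by exists (Var true) => x; rewrite inE.
(* Otherwise the values on [K] and the value at [y] could be prescribed independently, by
   [propagate], and [K] could be enlarged by [y]. *)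
have determined y (t t' : term S bool) : ~ E z y ->
    (forall x, x \in K -> tev J (v2 x z) t = tev J (v2 x z) t') ->
    tev J (v2 y z) t = tev J (v2 y z) t'.
  move=> zy tt'; have [/tt'//|yK] := boolP (y \in K).
  apply: contrapT => ntt'.
  pose B (w : A -> A) c := exists t : term S bool,
    (forall x, x \in K -> tev J (v2 x z) t = w x) /\ tev J (v2 y z) t = c.
  have iB : inv2 (pow J) J B.
    move=> o u v /fin_choice[ts tsE]; exists (App ts); split=> [x xK|] /=.
      by congr (J _ _); apply: funext => j; apply: (tsE j).1.
    by congr (J _ _); apply: funext => j; apply: (tsE j).2.
  have Bl w : exists c, B w c.
    by have [s sE] := fK w; exists (tev J (v2 y z) s), s.
  have [w wB] : exists w, forall c, B w c.
    apply: (full_section H (K := pow J)) => //.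
    - by move=> o x; apply: funext => i; exact: iJ.
    - move=> c; have [s sE] := split_term H c (split_nsym H zy).
      by exists (fun x => tev J (v2 x z) s), s.
    - exists (fun x => tev J (v2 x z) t), (tev J (v2 y z) t),
        (tev J (v2 y z) t').
      by split=> //; [exists t | exists t'; split=> // x /tt'].
  have fB := propagate H full iB Bl (ex_intro _ w wB).
  have yK' : P (y |: K).
    apply/asboolP; split=> [x /setU1P[->|/KN]//|w'].
    have [s [sE sy]] := fB w' (w' y); exists s.
    by move=> x /setU1P[->|/sE].
  have := Kmax _ yK' (subsetUr _ _) => KE.
  by move: yK; rewrite -KE setU11.
have [d dE] : exists d : term S 'I_3, forall x, x \in K ->
    tev J (v3 x z z) d = x /\ tev J (v3 z z x) d = x.
  pose M (g : bool * A -> A) := exists d : term S 'I_3, forall x, x \in K ->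
    tev J (v3 x z z) d = g (true, x) /\ tev J (v3 z z x) d = g (false, x).
  (* The coordinates [(true, x)] and [(false, x)] stand for the triples [(x, z, z)] and [(z, z, x)].
     An axis is reached by a binary term in two of the three variables: on triples of the other kind
     its arguments are both [z]. *)
  have := @axes_full _ _ _ _ H full z (bool * A)%type M.
  move=> /(_ _ _ _ (fun p => p.2)); apply.
  - by apply/card_gt0P; exists (true, z).
  - move=> o u /fin_choice[ts tsE]; exists (App ts) => x xK /=.
    by split; congr (J _ _); apply: funext => j; case: (tsE j x xK).
  - pose i1 := Ordinal (isT : 1 < 3); pose i2 := Ordinal (isT : 2 < 3).
    have v1z x : (fun b : bool => v3 x z z (if b then ord0 else i1)) = v2 x z.
      by apply: funext; case.
    have vz1 x : (fun b : bool => v3 z z x (if b then ord0 else i1)) = fun=> z.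
      by apply: funext; case.
    have v2z x : (fun b : bool => v3 z z x (if b then i2 else i1)) = v2 x z.
      by apply: funext; case.
    have vz2 x : (fun b : bool => v3 x z z (if b then i2 else i1)) = fun=> z.
      by apply: funext; case.
    move=> [b s] g g0; have [t tE] := fK (fun x => g (b, x)).
    exists (tsub (fun c : bool => Var (if c then if b then ord0 else i2 else
      i1)) t).
    move=> x xK; rewrite !tev_sub /=.
    case: b g0 tE => g0 tE.
      by rewrite v1z vz1 tE // tev_idem // (g0 (false, x)).
    by rewrite v2z vz2 tE // tev_idem // (g0 (true, x)).
exists d => y zy; split.
  have := @determined y (tsub (fun i => Var (v3 true false false i)) d)
    (Var true) zy.
  rewrite !tev_sub /=; have vE x : (fun i => v2 x z (v3 true false false i))
    = v3 x z z.
    exact: v3_comp.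
  by rewrite vE => -> // x xK; rewrite tev_sub vE; case: (dE x xK).
have := @determined y (tsub (fun i => Var (v3 false false true i)) d)
  (Var true) zy.
rewrite !tev_sub /=; have vE x : (fun i => v2 x z (v3 false false true i))
  = v3 z z x.
  exact: v3_comp.
by rewrite vE => -> // x xK; rewrite tev_sub vE; case: (dE x xK).
Qed.

(** Translations are automorphisms, so elements far from [z] generate the
    group. *)
Lemma maltsev_term : exists d : term S 'I_3, forall x,
  tev J (v3 x z z) d = x /\ tev J (v3 z z x) d = x.
Proof.
have [d dE] := far_axes_term; exists d => x.
have [zx|] := pselect (E z x); last exact: dE.
have [y zy] := split_other H z.
(* Translation by [y] preserves classes, so [add x y] lies in the class of [y]. The identities at
   [y] and at [add x y] then give those at [x] by additivity and cancellation. *)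
have zxy : ~ E z (add x y).
  move=> zxy; apply: zy; apply: (split_trans H zxy); apply: (split_sym H).
  have := split_hom H (hom2_l y (cg_hom G)) zx.
  by rewrite add0.
have [dxy1 dxy2] := dE _ zxy; have [dy1 dy2] := dE _ zy.
have v3D p q r p' q' r' : tev J (v3 (add p p') (add q q') (add r r')) d =
    add (tev J (v3 p q r) d) (tev J (v3 p' q' r') d).
  by rewrite -tev_add; congr (tev _ _ _); apply: funext => -[[|[|[|]]]].
split; apply: (@cgI y) => /=.
  by rewrite -[RHS]dxy1 -{1}dy1 -v3D add0.
by rewrite -[RHS]dxy2 -{1}dy2 -v3D add0.
Qed.

End Group.
End Quasigroup.
(** ** The module of a compatible group *)

Definition alg_ops S (A : algebra S) : ops S A :=
  fun o u => interp A o [tuple u j | j < arity o].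

Arguments alg_ops {S} A o u.

Lemma evalE S (A : algebra S) X (v : X -> A) t :
  eval (interp A) v t = tev (alg_ops A) v t.
Proof.
elim: t => //= o ts IH; rewrite /alg_ops; congr (interp A _ _).
by apply: eq_mktuple.
Qed.

Definition with_constants X A (v : X -> A) (y : X + A) : A :=
  match y with inl x => v x | inr a => a end.

Section Affine.
Variables (S : signature) (A : finType) (J : ops S A).
Variables (add : A -> A -> A) (z : A) (opp : A -> A).
Hypothesis G : compatible_group J add z opp.
Arguments J : clear implicits.
Hypothesis iJ : idem J.
Variable d : term S 'I_3.
Hypothesis dP : forall x, tev J (v3 x z z) d = x /\ tev J (v3 z z x) d = x.

Let addC := cg_comm G.
Let addA := cg_assoc G.
Let add0 := cg_add0 G.
Let addN := cg_addN G.

Let addz x : add x z = x. Proof. by rewrite addC add0. Qed.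

Lemma v3_add p q r p' q' r' : tev J (v3 (add p p') (add q q') (add r r')) d =
  add (tev J (v3 p q r) d) (tev J (v3 p' q' r') d).
Proof.
by rewrite -(tev_add G); congr (tev _ _ _); apply: funext => -[[|[|[|]]]].
Qed.

(** The triple [(x, z, y)] is the sum of [(x, z, z)] and [(z, z, y)], and [d] is additive. *)
Lemma maltsevD x y : tev J (v3 x z y) d = add x y.
Proof. by rewrite -[in RHS](dP x).1 -[in RHS](dP y).2 -v3_add !addz !add0. Qed.

(** Adding the triples [(x, z, z)] and [(z, z, x)] to [(z, x, z)] gives the constant triple [x],
    where [d] has value [x]. *)
Lemma maltsevN x : tev J (v3 z x z) d = opp x.
Proof.
apply: (cgI G (x := x)); rewrite /= addN.
rewrite -{2}(dP x).1 -v3_add add0 addz add0.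
apply: (cgI G (x := x)); rewrite /= add0 -{3}(dP x).2 -v3_add add0 !addz.
by rewrite (_ : v3 x x x = fun=> x) ?tev_idem //; apply: funext => -[[|[|[|]]]].
Qed.

Definition polynomial X (f : (X -> A) -> A) :=
  exists t : term S (X + A), forall v, f v = tev J (with_constants v) t.

Lemma polynomial_cst X a : polynomial (fun _ : X -> A => a).
Proof. by exists (Var (inr a)). Qed.

Lemma polynomial_var X x : polynomial (fun v : X -> A => v x).
Proof. by exists (Var (inl x)). Qed.

Lemma polynomial_tev X Y (f : Y -> (X -> A) -> A) (t : term S Y) :
  (forall y, polynomial (f y)) -> polynomial (fun v => tev J (f^~ v) t).
Proof.
move=> /fin_choice[s sE]; exists (tsub s t) => v.
by rewrite tev_sub; congr (tev _ _ _); apply: funext => y.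
Qed.

Lemma polynomial_sub X Y (f : (Y -> A) -> A) (g : Y -> (X -> A) -> A) :
  polynomial f -> (forall y, polynomial (g y)) ->
  polynomial (fun v => f (g^~ v)).
Proof.
move=> [t tE] pg; have [|u uE] := @polynomial_tev X _
  (fun y v => with_constants (g^~ v) y) t.
  by case=> [y|a]; [exact: pg | exact: polynomial_cst].
by exists u => v; rewrite tE -uE.
Qed.

Lemma polynomial_v3 X (f g h : (X -> A) -> A) :
  polynomial f -> polynomial g -> polynomial h ->
  polynomial (fun v => tev J (v3 (f v) (g v) (h v)) d).
Proof.
move=> pf pg ph; have [|t tE] := @polynomial_tev X _ (v3 f g h) d.
  by case=> [[|[|[|]]]].
exists t => v; rewrite -tE; congr (tev _ _ _).
by apply: funext => -[[|[|[|]]]].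
Qed.

Lemma polynomial_add X (f g : (X -> A) -> A) :
  polynomial f -> polynomial g -> polynomial (fun v => add (f v) (g v)).
Proof.
move=> pf pg; have [t tE] := polynomial_v3 pf (@polynomial_cst X z) pg.
by exists t => v; rewrite -tE maltsevD.
Qed.

Lemma polynomial_opp X (f : (X -> A) -> A) :
  polynomial f -> polynomial (fun v => opp (f v)).
Proof.
move=> pf; have [t tE] := polynomial_v3 (@polynomial_cst X z)
  pf (@polynomial_cst X z).
by exists t => v; rewrite -tE maltsevN.
Qed.

(** Both sides evaluate one term at a sum of two assignments; the summand at [z] doubles each
    constant on the left, as happens on the right. *)
Lemma polynomialD X (f : (X -> A) -> A) (v w : X -> A) : polynomial f ->
  add (f (fun x => add (v x) (w x))) (f (fun=> z)) = add (f v) (f w).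
Proof.
case=> t tE; rewrite !tE -!(tev_add G); congr (tev _ _ _).
by apply: funext => -[x|a] //=; rewrite addz.
Qed.

(** The elements of the ring acting on the group. *)
Definition endo_spec (f : A -> A) :=
  f z = z /\ polynomial (fun v : unit -> A => f (v tt)).

(** Indexing the type by the proof [G] lets the ring structure, which is built from that group, be
    attached to it canonically; [gcar] does the same for the module. *)
Definition endo (_ : compatible_group J add z opp) := {f : A ->
  A | endo_spec f}.
Local Notation R := (endo G).

Lemma endo_ext (f g : R) : sval f =1 sval g -> f = g.
Proof.
case: f g => [f fP] [g gP] /= /funext fg; case: g / fg gP => gP.
by congr exist; exact: Prop_irrelevance.
Qed.

Lemma endo_add_spec (f g : R) : endo_spec (fun x => add (sval f x) (sval g x)).
Proof.
case: f g => [f [f0 fP]] [g [g0 gP]]; split; first by rewrite /= f0 g0 add0.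
exact: polynomial_add.
Qed.

Lemma endo_opp_spec (f : R) : endo_spec (fun x => opp (sval f x)).
Proof.
case: f => [f [f0 fP]]; split; first by rewrite /= f0 -(addz (opp z)) addN.
exact: polynomial_opp.
Qed.

Lemma endo_mul_spec (f g : R) : endo_spec (fun x => sval f (sval g x)).
Proof.
case: f g => [f [f0 fP]] [g [g0 gP]]; split; first by rewrite /= g0 f0.
exact: (@polynomial_sub _ _ (fun v => f (v tt)) (fun _ v => g (v tt))).
Qed.

Lemma endo_zero_spec : endo_spec (fun=> z).
Proof. by split; last exact: polynomial_cst. Qed.

Lemma endo_one_spec : endo_spec id.
Proof. by split; last exact: polynomial_var. Qed.

Definition endo_add f g : R := exist _ _ (endo_add_spec f g).
Definition endo_opp f : R := exist _ _ (endo_opp_spec f).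
Definition endo_mul f g : R := exist _ _ (endo_mul_spec f g).
Definition endo_zero : R := exist _ _ endo_zero_spec.
Definition endo_one : R := exist _ _ endo_one_spec.

Lemma endoD (f : R) x y : sval f (add x y) = add (sval f x) (sval f y).
Proof.
case: f => f [f0 fP] /=.
by have := polynomialD (fun=> x) (fun=> y) fP; rewrite /= f0 addz.
Qed.

HB.instance Definition _ := gen_eqMixin R.
HB.instance Definition _ := gen_choiceMixin R.

Lemma endo_addA : associative endo_add.
Proof. by move=> f g h; apply: endo_ext => x /=; rewrite addA. Qed.
Lemma endo_addC : commutative endo_add.
Proof. by move=> f g; apply: endo_ext => x /=; rewrite addC. Qed.
Lemma endo_add0 : left_id endo_zero endo_add.
Proof. by move=> f; apply: endo_ext => x /=; rewrite add0. Qed.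
Lemma endo_addN : left_inverse endo_zero endo_opp endo_add.
Proof. by move=> f; apply: endo_ext => x /=; rewrite addN. Qed.

HB.instance Definition _ :=
  GRing.isZmodule.Build R endo_addA endo_addC endo_add0 endo_addN.

Lemma endo_mulA : associative endo_mul.
Proof. by move=> f g h; apply: endo_ext. Qed.
Lemma endo_mul1 : left_id endo_one endo_mul.
Proof. by move=> f; apply: endo_ext. Qed.
Lemma endo_1mul : right_id endo_one endo_mul.
Proof. by move=> f; apply: endo_ext. Qed.
Lemma endo_mulDl : left_distributive endo_mul endo_add.
Proof. by move=> f g h; apply: endo_ext. Qed.
Lemma endo_mulDr : right_distributive endo_mul endo_add.
Proof. by move=> f g h; apply: endo_ext => x /=; rewrite endoD. Qed.

HB.instance Definition _ := GRing.Zmodule_isPzRing.Build R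
  endo_mulA endo_mul1 endo_1mul endo_mulDl endo_mulDr.

Definition gcar (_ : compatible_group J add z opp) : Type := A.
Local Notation V := (gcar G).

HB.instance Definition _ := Choice.on V.
HB.instance Definition _ := GRing.isZmodule.Build V addA addC add0 addN.

Definition gcar_scale (f : R) (x : V) : V := sval f x.

Lemma gcar_scaleA f g x : gcar_scale f (gcar_scale g x)
  = gcar_scale (f * g)%R x.
Proof. by []. Qed.
Lemma gcar_scale1 : left_id 1%R gcar_scale.
Proof. by []. Qed.
Lemma gcar_scaleDr : right_distributive gcar_scale +%R.
Proof. by move=> f x y; exact: endoD. Qed.
Lemma gcar_scaleDl x : {morph gcar_scale^~ x : f g / (f + g)%R}.
Proof. by []. Qed.

HB.instance Definition _ := GRing.Zmodule_isLmodule.Build R V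
  gcar_scaleA gcar_scale1 gcar_scaleDr gcar_scaleDl.

Local Notation mod_eval v t :=
  (eval (module_interp (V : GRing.Lmodule.type R)) (with_constants v) t).

Lemma module_poly_polynomial X (t : term (module_sig R) (X + A)) :
  polynomial (fun v : X -> A => mod_eval v t).
Proof.
elim: t => [[x|a]|o ts IH].
- exact: polynomial_var.
- exact: polynomial_cst.
case: o ts IH => [|||f] ts IH /=.
- exact: polynomial_cst.
- have [t tE] := polynomial_opp (IH ord0).
  by exists t => v; rewrite -tE tnth_mktuple.
- have [t tE] := polynomial_add (IH ord0) (IH ord_max).
  by exists t => v; rewrite -tE !tnth_mktuple.
- have [f0 pf] := svalP f.
  have [t tE] := polynomial_sub pf (fun=> IH ord0).
  by exists t => v; rewrite -tE tnth_mktuple.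
Qed.

(** Variables are added one at a time, those outside [s] being set to [z]; each contributes a
    summand that is a ring element applied to it. *)
Lemma polynomial_module_poly (X : finType) (f : (X -> A) -> A) : polynomial f ->
  exists t : term (module_sig R) (X + A), forall v, f v = mod_eval v t.
Proof.
move=> pf; pose res (s : seq X) (v : X -> A) x := if x \in s then v x else z.
suff [t tE] : exists t : term (module_sig R) (X + A), forall v,
    f (res (enum X) v) = mod_eval v t.
  exists t => v; rewrite -tE; congr f; apply: funext => x.
  by rewrite /res mem_enum.
elim: (enum X) (enum_uniq X) => /= [_|x s IH /andP[xs /IH[t tE]]].
  by exists (Var (inr (f (fun=> z)))).
(* [polynomialD] splits off the variable [x] up to the constant term of [f]; subtracting that term
   makes [g] fix [z], so that it is a scalar. *)
pose g y := add (opp (f (fun=> z))) (f (fun x' => if x' == x then y else z)).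
have g_spec : endo_spec g.
  split.
    rewrite /g (_ : (fun x' => _) = fun=> z) ?addN //.
    by apply: funext => x'; case: eqP.
  apply: polynomial_add; first exact: polynomial_cst.
  apply: (polynomial_sub (g := fun x' v => if x' == x then v tt else z))
    => // y.
  by case: eqP => _; [exact: polynomial_var | exact: polynomial_cst].
pose c := exist _ g g_spec : R.
exists (App (o := MAdd R : sym (module_sig R))
  (fun i => if i == ord0 then t else
  App (o := MScale c : sym (module_sig R)) (fun=> Var (inl x)))) => v.
rewrite /= !tnth_mktuple /= tnth_mktuple /= -tE.
rewrite -[RHS]/(add _ (g (v x))) /g.
pose w x' := if x' == x then v x else z.
rewrite -/w.
set f0 := f (fun=> z).
have <- : (fun x' => add (res s v x') (w x')) = res (x :: s) v.
  apply: funext => x'; rewrite /res /w inE; case: eqP => [->|_] /=.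
    by rewrite (negPf xs) add0.
  by rewrite addz.
apply: (cgI G (x := f0)); rewrite /= polynomialD // -addA; congr add.
by rewrite [X in add X f0]addC -addA addN addz.
Qed.

Lemma polynomial_clone_affine : exists (Q : pzRingType)
  (c : GRing.Lmodule.axioms_ Q A),
  forall n (f : n.-tuple A -> A),
    (exists t : term S ('I_n + A), forall v,
       f v = tev J (with_constants (tnth v)) t) <->
    poly_op (module_interp (GRing.Lmodule.Pack c)) f.
Proof.
exists R, (GRing.Lmodule.class (V : GRing.Lmodule.type R)) => n f.
split=> -[t tE].
  have [|u uE] := @polynomial_module_poly 'I_n
    (fun v => tev J (with_constants v) t); first by exists t.
  by exists u => v; rewrite tE uE.
have [u uE] := module_poly_polynomial t.
by exists u => v; rewrite tE -uE.
Qed.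

End Affine.
(** ** Relations over an algebra without compatible quasigroups *)

Section NonLatin.
Variables (S : signature) (A : finType) (J : ops S A) (E : A -> A -> Prop).
Arguments J : clear implicits.
Hypothesis H : split_algebra J E.
Hypothesis full : full_orders J E.
Hypothesis nolatin : forall f, ~ latin J f.

Let iJ := split_idem H.

Lemma idem_pow X : idem (pow (I:=X) J).
Proof. by move=> o x; apply: funext => i; exact: iJ. Qed.

(** Fixing all coordinates but three of a minimal counterexample gives the
    graph of a quasigroup. *)
Lemma nonlatin_full (X : finType) (M : (X -> A) -> Prop) :
  inv1 (pow J) M -> (exists w, M w) -> (forall s c, exists w, M w /\ w s = c) ->
  (forall s t c d, s != t -> exists w, [/\ M w, w s = c & w t = d]) ->
  forall w, M w.
Proof.
move=> iM [w1 Mw1] M1 M2.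
pose ext (K : {set X}) w := exists w', M w' /\ forall x, x \in K -> w' x = w x.
suff extM (K : {set X}) w : ext K w.
  move=> w; have [w' [Mw' ww']] := extM setT w.
  by rewrite (_ : w = w') //; apply: funext => x; rewrite ww' ?inE.
have [n] := ubnP #|K|; elim: n K w => // n IH K w le_n.
have [->|[s sK]] := set_0Vmem K; first by exists w1; split=> // x; rewrite inE.
have [Ks|[t]] := set_0Vmem (K :\ s).
  have [w' [Mw' w's]] := M1 s (w s); exists w'; split=> // x xK.
  by move/setP/(_ x): Ks; rewrite !inE xK andbT => /negbFE/eqP->.
rewrite !inE => /andP[ts tK].
have [Kst|[r]] := set_0Vmem (K :\ s :\ t).
  have [|w' [Mw' w's w't]] := M2 s t (w s) (w t); first by rewrite eq_sym.
  exists w'; split=> // x xK; move/setP/(_ x): Kst; rewrite !inE xK andbT.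
  by have [->|_] := eqVneq x t => //=; move/negbFE/eqP => ->.
rewrite !inE => /and3P[rt rs rK].
have iext (o : sym S) (u : 'I_(arity o) -> X -> A) :
    (forall j, ext K (u j)) -> ext K (pow J o u).
  move=> /fin_choice[v Hv]; exists (pow J o v); split=> [|x xK].
    by apply: iM => j; case: (Hv j).
  by congr (J _ _); apply: funext => j; case: (Hv j) => _ ->.
have extU x w' : x \in K -> exists c, ext K (upd w' x c).
  move=> xK; have [|v [Mv vE]] := IH (K :\ x) w'.
    by move: le_n; rewrite (cardsD1 x K) xK.
  exists (v x), v; split=> // y yK; rewrite /upd; case: eqP => [->//|/eqP yx].
  by rewrite vE // !inE yx.
pose B v c := ext K (upd v t c).
have iB : inv2 (pow J) J B.
  move=> o u v uv; rewrite /B.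
  rewrite (_ : upd _ _ _ = pow J o (fun j => upd (u j) t (v j)));
    first exact: iext.
  by apply: funext => x; rewrite /upd /pow; case: eqP.
have Bl v : exists c, B v c by exact: extU.
(* If some assignment of the other coordinates leaves [t] free, [propagate] frees it everywhere.
   Otherwise no section is full, and below this makes the value at [t] a bijective function of each
   of the coordinates [r] and [s]. *)
have [fB|nfB] := pselect (exists v, forall c, B v c).
  by rewrite -(upd_id w t); exact: (propagate H full iB Bl fB).
pose h e c := upd (upd w r e) s c.
have hh o u v : pow J o (fun j => h (u j) (v j)) = h (J o u) (J o v).
  apply: funext => x; rewrite /pow /h /upd.
  by case: eqP => // _; case: eqP => // _; rewrite iJ.
have Q_inv o u v q : (forall j, B (h (u j) (v j)) (q j)) ->
    B (h (J o u) (J o v)) (J o q).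
  by move=> uvq; rewrite -hh; exact: iB.
have gr1 e c c' d d' : B (h e c) d -> B (h e c') d' -> (c = c' <-> d = d').
  have [|||gr] := @graph_or_centers _ _ _ _ H (fun c d => B (h e c) d).
  - by move=> o u v uv; rewrite -{1}(iJ o e); exact: Q_inv.
  - split=> [x|y]; first exact: Bl.
    have [x xP] := extU s (upd (upd w r e) t y) sK.
    by exists x; rewrite /B /h updC // eq_sym.
  - exact.
  - by case: gr => -[x xB] _; case: nfB; exists (h e x).
have gr2 c e e' d d' : B (h e c) d -> B (h e' c) d' -> (e = e' <-> d = d').
  have [|||gr] := @graph_or_centers _ _ _ _ H (fun e d => B (h e c) d).
  - by move=> o u v uv; rewrite -{1}(iJ o c); exact: Q_inv.
  - split=> [x|y]; first exact: Bl.
    have [x xP] := extU r (upd (upd w s c) t y) rK.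
    by exists x; rewrite /B /h (updC _ x c rs) updC // eq_sym.
  - exact.
  - by case: gr => -[x xB] _; case: nfB; exists (h x c).
have [f fP] : exists f : A -> A -> A, forall e c, B (h e c) (f e c).
  have [f fP] := fin_choice (fun p : A * A => Bl (h p.1 p.2)).
  by exists (fun e c => f (e, c)) => e c; exact: (fP (e, c)).
case: (@nolatin f); split=> [o u v|e c c' cc|c e e' ee].
- by apply/(gr1 _ _ _ _ _ (fP _ _) (Q_inv _ _ _ _ (fun j => fP (u j) (v j)))).
- by apply/(gr1 _ _ _ _ _ (fP e c) (fP e c')).
- by apply/(gr2 _ _ _ _ _ (fP e c) (fP e' c)).
Qed.

(** The kernel of evaluation at [r] is not contained in that at [r']: the relation between the two
    values is not a function of the first. *)
Definition separates Z (r r' : Z -> A) := exists t t' : term S Z,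
  tev J r t = tev J r t' /\ tev J r' t <> tev J r' t'.

(** Each row has two far entries, so it generates the algebra. Separation makes the relation between
    two rows linked, hence full, and [nonlatin_full] does the rest. *)
Lemma rows_full (I : finType) Z (r : I -> Z -> A) (z0 : Z) :
  (forall s, exists i j, ~ E (r s i) (r s j)) ->
  (forall s s', s != s' -> separates (r s) (r s') \/ separates (r s') (r s)) ->
  forall w, exists t, forall s, tev J (r s) t = w s.
Proof.
move=> rE rsep.
have r1 s c : exists t, tev J (r s) t = c.
  have [i [j rij]] := rE s; have [t tE] := split_term H c rij.
  exists (tsub (v2 (Var i) (Var j)) t); rewrite tev_sub -tE.
  by congr (tev _ _ _); apply: funext; case.
apply: nonlatin_full.
- by move=> o u /fin_choice[ts tsE]; exists (App ts) => s /=;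
    congr (J _ _); apply: funext => j; apply: tsE.
- by exists (fun s => r s z0), (Var z0).
- by move=> s c; have [t tE] := r1 s c; exists (fun s => tev J (r s) t);
  split=> //; exists t.
move=> s s' c d ss'.
pose R c d := exists t, tev J (r s) t = c /\ tev J (r s') t = d.
have R_full : forall c d, R c d.
  have iR : inv2 J J R by exact: inv2_gen.
  have oR : onto2 R.
    split=> x.
      by have [t tE] := r1 s x; exists (tev J (r s') t), t.
    by have [t tE] := r1 s' x; exists (tev J (r s) t), t.
  case: (rsep s s' ss') => -[t [t' [tt' ntt']]].
    apply: (linked_full H full iR oR).
    exists (tev J (r s) t), (tev J (r s') t), (tev J (r s') t').
    by split=> //; [exists t | exists t'].
  move=> x y; apply: (linked_full H full (inv2_sym iR)).
    by case: oR.
  exists (tev J (r s') t), (tev J (r s) t), (tev J (r s) t').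
  by split=> //; [exists t | exists t'].
have [t [tc td]] := R_full c d.
by exists (fun s => tev J (r s) t); split=> //; exists t.
Qed.

(** The tuples [(w_i)_i] of elements of [X -> A] having a common [F]-partner
    form a relation with full binary projections. *)
Lemma full_fibre (X : finType) Y (K : ops S Y) (F : (X -> A) -> Y -> Prop) :
  inv2 (pow J) K F -> (forall w, exists p, F w p) ->
  (forall s, exists p w w', [/\ F w p, F w' p & w s <> w' s]) ->
  exists p, forall w, F w p.
Proof.
move=> iF Fl Fs; pose W := {ffun X -> A}.
pose M (g : X * W -> A) := exists p, forall v : W, F (fun x => g (x, v)) p.
have Mcst w : M (fun y => w y.1) by have [p wp] := Fl w; exists p.
suff Mfull : forall g, M g.
  (* The coordinates are pairs of a position and a tuple; reading each tuple at its position lists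
     all tuples at once, and they get a common partner. *)
  have [p pF] := Mfull (fun y => y.2 y.1); exists p => w.
  have := pF (finfun w); rewrite (_ : (fun x => _) = w) //.
  by apply: funext => x /=; rewrite ffunE.
apply: nonlatin_full.
- move=> o u /fin_choice[p pF]; exists (K o p) => v.
  by apply: (iF o (fun j x => u j (x, v))) => j; exact: pF.
- by have [a _] := split_neq H; exists (fun=> a); exact: (Mcst (fun=> a)).
- by move=> s c; exists (fun=> c); split=> //; exact: (Mcst (fun=> c)).
move=> [s v] [s' v'] c d ss'.
have [eq_s|ns] := eqVneq s s'; last first.
  exists (fun y => if y.1 == s then c else d) => /=.
  rewrite eqxx eq_sym (negPf ns); split=> //.
  exact: (Mcst (fun x => if x == s then c else d)).
subst s'; have vv' : v' != v by apply: contraNneq ss' => ->.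
pose R c d := exists p w w', [/\ F w p, F w' p, w s = c & w' s = d].
have [p [w [w' [wp w'p wc wd]]]] : R c d.
  apply: (linked_full H full (R := R)).
  - move=> o u q /fin_choice[p /fin_choice[w /fin_choice[w' Hw]]].
    exists (K o p), (pow J o w), (pow J o w'); split.
    + by apply: iF => j; case: (Hw j).
    + by apply: iF => j; case: (Hw j).
    + by congr (J _ _); apply: funext => j; case: (Hw j).
    + by congr (J _ _); apply: funext => j; case: (Hw j).
  - split=> x; exists x; have [p xp] := Fl (fun=> x);
      by exists p, (fun=> x), (fun=> x).
  - have [p [w [w' [wp w'p ww']]]] := Fs s.
    exists (w s), (w s), (w' s); split=> //; first by exists p, w, w.
    by exists p, w, w'.
exists (fun y => if y.2 == v then w y.1 else w' y.1); split.
- by exists p => q /=; case: (q =P v).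
- by rewrite /= eqxx.
- by rewrite /= (negPf vv').
Qed.

(** In any two of the three rows, some two variables agree in one row and differ in the other, so
    [rows_full] allows all values to be [a]. *)
Lemma local_majority a b : ~ E a b -> exists t : term S 'I_3,
  [/\ tev J (v3 a a b) t = a, tev J (v3 a b a) t = a & tev J (v3 b a a) t = a].
Proof.
move=> ab; have nab := split_neqx H ab.
pose i1 := Ordinal (isT : 1 < 3); pose i2 := Ordinal (isT : 2 < 3).
pose r := tnth [tuple v3 a a b; v3 a b a; v3 b a a].
have [||t tE] := @rows_full _ _ r ord0 _ _ (fun=> a).
- case=> [[|[|[|]]]] // i; [exists ord0, i2 | exists ord0, i1 | exists i1,
  ord0];
    by rewrite /r !(tnth_nth (v3 a a b)) /= /v3 !(tnth_nth a).
- have sep (p q : 'I_3 -> A) i j : p i = p j -> q i <> q j -> separates p q.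
    by move=> pij qij; exists (Var i), (Var j).
  by case=> [[|[|[|]]] i] // [[|[|[|]]] j] // _;
   rewrite /r !(tnth_nth (v3 a a b)) /=; left;
   (do [by apply: (sep _ _ ord0 i1); rewrite /v3 !(tnth_nth a) //= => /esym
      | by apply: (sep _ _ ord0 i2); rewrite /v3 !(tnth_nth a) //= => /esym
      | by apply: (sep _ _ i1 i2); rewrite /v3 !(tnth_nth a) //= => /esym]).
by exists t; have := (tE ord0, tE i1, tE i2);
  rewrite /r !(tnth_nth (v3 a a b)) /= => -[[]].
Qed.

End NonLatin.
(** * Clones without Taylor operations *)

Fixpoint leaf n (i : 'I_n) X (e : term (op_sig n) X) : X :=
  match e with Var x => x | App o es => leaf i (es i) end.

Lemma eval_projection n (i : 'I_n) Y X (v : X -> Y) e :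
  eval (op_interp (@projection Y n i)) v e = v (leaf i e).
Proof. by elim: e => //= o es IH;
  rewrite -IH /op_interp /projection tnth_mktuple. Qed.

Lemma leaf_sub n (i : 'I_n) X Y (s : X -> Y) e :
  leaf i (tsub (fun x => Var (s x)) e) = s (leaf i e).
Proof. by elim: e => //= o es IH; rewrite -IH. Qed.

Lemma eval_ren S Y (I : interpretation S Y) X Z (s : X -> Z) (v : Z -> Y) e :
  eval I v (tsub (fun x => Var (s x)) e) = eval I (v \o s) e.
Proof. by elim: e => //= o es IH; congr (I _ _); exact: eq_mktuple. Qed.

(** A projection satisfies an identity on [bool] as soon as both sides have the same leaf. *)
Lemma taylor_leaf X n (f : operation X n) : taylor_op f -> forall i : 'I_n,
  exists m (e1 e2 : term (op_sig n) 'I_m),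
    (forall v, eval (op_interp f) v e1 = eval (op_interp f) v e2) /\
    leaf i e1 <> leaf i e2.
Proof.
move=> [_ [m [k [e [fe np]]]]] i; apply: contrapT => nl.
apply: (np bool true false _ i) => // j v; rewrite !eval_projection.
congr v; apply: contrapT => ne; apply: nl.
by exists m, (e j).1, (e j).2; split.
Qed.

(** If every projection violated some identity of [f], these [n] identities, with variables widened
    to a common range, would form a Taylor system. *)
Lemma not_taylor_leaf X n (f : operation X n) : idempotent_op f ->
  ~ taylor_op f -> exists i : 'I_n,
    forall (Z : finType) (e1 e2 : term (op_sig n) Z),
    (forall v, eval (op_interp f) v e1 = eval (op_interp f) v e2) ->
    leaf i e1 = leaf i e2.
Proof.
move=> idf ntf; apply: contrapT => /contra_ex bad; apply: ntf; split=> //.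
have {bad}/fin_choice[w wP] : forall i : 'I_n,
    exists w : {m & (term (op_sig n) 'I_m * term (op_sig n) 'I_m)%type},
    (forall v, eval (op_interp f) v (projT2 w).1 =
               eval (op_interp f) v (projT2 w).2) /\
    leaf i (projT2 w).1 <> leaf i (projT2 w).2.
  move=> i; apply: contrapT => /contra_ex nw; apply: (bad i) => Z e1 e2 e12.
  pose ren := tsub (fun x : Z => Var (S := op_sig n) (enum_rank x)).
  apply: contrapT => nl; apply: (nw (existT _ #|Z| (ren e1, ren e2))) => /=.
  by split=> [v|]; rewrite ?eval_ren ?e12 // !leaf_sub => /enum_rank_inj.
pose m := \max_i projT1 (w i).
pose wid i := tsub (fun x => Var (S := op_sig n)
  (widen_ord (leq_bigmax (F := fun i => projT1 (w i)) i) x)).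
exists m, n, (fun j => (wid j (projT2 (w j)).1, wid j (projT2 (w j)).2)).
split=> [j v|Y y1 y2 y12 i]; first by rewrite !eval_ren; apply: (wP j).1.
set x1 := leaf i (wid i (projT2 (w i)).1).
move=> /(_ i (fun x => if x == x1 then y1 else y2)).
rewrite !eval_projection /= -/x1 eqxx; case: eqP => // /eqP.
rewrite /x1 !leaf_sub -val_eqE /= => /eqP/val_inj/esym.
by case: (wP i).
Qed.

Definition term_fun S X (K : ops S X) n (t : term S 'I_n) : operation X n :=
  fun v => tev K (tnth v) t.

Fixpoint expand S n (t : term S 'I_n) X (e : term (op_sig n) X) : term S X :=
  match e with
  | Var x => Var x
  | App o es => tsub (fun i : 'I_n => expand t (es i)) t
  end.

Lemma eval_expand S X (K : ops S X) n (t : term S 'I_n) Y (v : Y -> X) e :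
  eval (op_interp (term_fun K t)) v e = tev K v (expand t e).
Proof.
elim: e => //= o es IH; rewrite tev_sub /op_interp /term_fun.
by congr (tev _ _ _); apply: funext => i; rewrite tnth_mktuple IH.
Qed.

Section NonTaylor.
Variables (S : signature) (M : finType) (K : ops S M).
Arguments K : clear implicits.
Hypothesis iK : idem K.
Variable D : forall X : Type, term S X -> Prop.
Hypothesis D_var : forall X (x : X), D (Var x).
Hypothesis D_sub : forall X Y (s : X -> term S Y) t,
  D t -> (forall x, D (s x)) -> D (tsub s t).

Definition minor X Y (t : term S X) (t' : term S Y) := exists p : Y -> X,
  forall v : X -> M, tev K v t = tev K (v \o p) t'.

(** Composing [t i] with copies of [u] on disjoint variables has both as minors: by idempotence,
    identifying the variables within each copy returns [t i], and identifying the copies returns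
    [u]. *)
Lemma common_major (I : finType) (X : I -> finType) (t : forall i,
  term S (X i)) :
  (forall i, D (t i)) ->
  exists (Y : finType) (u : term S Y), D u /\ forall i, minor (t i) u.
Proof.
move=> Dt.
suff [Y [u [Du tu]]] : exists (Y : finType) (u : term S Y), D u /\
    forall i, i \in enum I -> minor (t i) u.
  by exists Y, u; split=> // i; apply: tu; rewrite mem_enum.
elim: (enum I) => [|i s [Y [u [Du tu]]]]; first by exists unit, (Var tt).
exists (X i * Y)%type, (tsub (fun x => tsub (fun y => Var (x, y)) u) (t i)).
split; first by apply: D_sub => // x; apply: D_sub.
move=> j; rewrite inE => /predU1P[->|/tu[p pP]].
  exists fst => v; rewrite tev_sub; congr (tev _ _ _); apply: funext => x.
  by rewrite tev_sub /= tev_idem.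
exists (p \o snd) => v; rewrite tev_sub.
rewrite (_ : (fun x => _) = fun=> tev K v (t j)) ?tev_idem //.
by apply: funext => x; rewrite tev_sub pP.
Qed.

Hypothesis nonTaylor : forall n (t : term S 'I_n),
  D t -> ~ taylor_op (term_fun K t).

Definition acts_as_projections (X B : Type) (J : ops S B) (C : B -> Prop)
    (h : B -> bool) :=
  forall t : term S X, D t -> exists x, forall v : X -> B,
    (forall y, C (v y)) -> h (tev J v t) = h (v x).

Definition closedD (B : Type) (J : ops S B) (C : B -> Prop) :=
  forall X (t : term S X) (v : X -> B), D t -> (forall y,
    C (v y)) -> C (tev J v t).

Definition splits B (C : B -> Prop) (h : B -> bool) :=
  exists p q, [/\ C p, C q & h p <> h q].

(** The identities between the binary operations of the clone and those of
    arity [X] involve finitely many operations, all minors of a single one;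
    as that one is not Taylor, some projection satisfies its identities. *)
Lemma binary_part_projections (X : finType) (x0 : X) :
  exists C h, [/\ closedD (pow (I := M * M) K) C, splits C h
    & acts_as_projections X (pow (I := M * M) K) C h].
Proof.
pose FF := {ffun M * M -> M}; pose GG := {ffun {ffun X -> M} -> M}.
pose inF (q : M * M -> M) :=
  exists t : term S bool, D t /\ forall x, q x = tev K (v2 x.1 x.2) t.
have /fin_choice[tq tqP] : forall q : FF, exists t : term S bool,
    D t /\ (inF q -> forall x, q x = tev K (v2 x.1 x.2) t).
  move=> q; have [[t [Dt tE]]|nF] := pselect (inF q).
    by exists t.
  by exists (Var true).
have /fin_choice[tg tgP] : forall g : GG, exists t' : term S X,
    D t' /\ forall t, D t -> (forall v, g v = tev K v t) ->
      forall v, tev K v t' = tev K v t.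
  move=> g; have [[t [Dt tE]]|nG] := pselect (exists t, D t /\ forall v,
    g v = tev K v t).
    exists t; split=> // u _ uE v.
    have vE : v = finfun v by apply: funext => x; rewrite ffunE.
    by rewrite vE -tE uE.
  by exists (Var x0); split=> // t Dt tE; case: nG; exists t.
pose X_ (i : FF + GG) : finType := if i is inl _ then bool else X.
pose t_ (i : FF + GG) : term S (X_ i) :=
  match i with inl q => tq q | inr g => tg g end.
have [|Y [u [Du tu]]] := @common_major (FF + GG)%type X_ t_.
  by case=> [q|g]; [case: (tqP q) | case: (tgP g)].
pose n := #|Y|; pose T : term S 'I_n := tsub (fun y => Var (enum_rank y)) u.
have DT : D T by apply: D_sub.
have [|i iP] := not_taylor_leaf _ (nonTaylor DT).
  move=> x; rewrite /term_fun; have -> : tnth (nseq_tuple n x) = fun=> x.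
    by apply: funext => j; rewrite (tnth_nth x) nth_nseq ltn_ord.
  exact: tev_idem.
pose op Z W (p : Y -> W) (s : W -> term (op_sig n) Z) : term (op_sig n) Z :=
  @App (op_sig n) Z tt (fun j : 'I_n => s (p (enum_val j))).
have opE Z W (p : Y -> W) s (v : Z -> M) (t : term S W) :
    (forall v : W -> M, tev K v t = tev K (v \o p) u) ->
    eval (op_interp (term_fun K T)) v (op Z W p s) =
    tev K (fun x => eval (op_interp (term_fun K T)) v (s x)) t.
  move=> tE; rewrite tE /= {1}/op_interp {1}/term_fun /T tev_sub.
  by congr (tev _ _ _); apply: funext => y; rewrite /= tnth_mktuple enum_rankK.
have /fin_choice[pq pqE] : forall q : FF, exists p : Y -> bool, forall v,
    tev K v (tq q) = tev K (v \o p) u := fun q => tu (inl q).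
have /fin_choice[pg pgE] : forall g : GG, exists p : Y -> X, forall v,
    tev K v (tg g) = tev K (v \o p) u := fun g => tu (inr g).
pose y := enum_val i.
(* All operations are minors of [T], and the projection to [y] satisfies the identities of [T]; [h]
   records which of the two variables [q] puts in place [y]. *)
pose h (q : M * M -> M) : bool := pq (finfun q) y.
have tqE (q : M * M -> M) (w : bool -> M) : inF q ->
    tev K w (tq (finfun q)) = q (w true, w false).
  case=> t [Dt tE]; have [_ /(_ _ (w true, w false))] := tqP (finfun q).
  rewrite ffunE (_ : v2 _ _ = w); last by apply: funext; case.
  by move=> -> //; exists t; split=> // x; rewrite ffunE.
have Fclosed : closedD (pow K) inF.
  move=> X' t v Dt /fin_choice[s sP]; exists (tsub s t); split=> [|x].
    by apply: D_sub => // x; case: (sP x).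
  rewrite tev_pow tev_sub; congr (tev _ _ _); apply: funext => x'.
  by case: (sP x') => _ ->.
exists inF, h; split=> //.
- have F1 : inF fst by exists (Var true).
  have F2 : inF snd by exists (Var false).
  have h1 : h fst = true.
    apply: (iP bool (op _ _ (pq (finfun fst)) (Var (S := op_sig n)))
      (Var true)) => w.
    by rewrite (opE _ _ _ _ _ (tq (finfun fst))) //= tqE.
  have h2 : h snd = false.
    apply: (iP bool (op _ _ (pq (finfun snd)) (Var (S := op_sig n)))
      (Var false)) => w.
    by rewrite (opE _ _ _ _ _ (tq (finfun snd))) //= tqE.
  by exists fst, snd; rewrite h1 h2.
move=> t Dt; pose g : GG := [ffun v : {ffun X -> M} => tev K v t].
exists (pg g y) => v vF.
apply/esym/(iP bool
  (op _ _ (pg g) (fun x => op _ _ (pq (finfun (v x))) (Var (S := op_sig n))))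
  (op _ _ (pq (finfun (tev (pow K) v t))) (Var (S := op_sig n)))) => w.
rewrite (opE _ _ _ _ _ (tg g)) // (opE _ _ _ _ _ (tq (finfun (tev (pow K)
  v t)))) //.
have [_ /(_ t Dt) ->] := tgP g; last by move=> x; rewrite ffunE.
rewrite [RHS]tqE; last exact: Fclosed.
rewrite tev_pow; congr (tev _ _ _); apply: funext => x.
by rewrite (opE _ _ _ _ _ (tq (finfun (v x)))) // tqE.
Qed.

(** Induction on the coordinates where elements of [C] may differ. If two elements agree at [i] but
    differ under [h], fix that coordinate, which idempotence allows; otherwise [h] factors through
    coordinate [i] and [C] is projected to it. *)
Lemma project_projections (I : finType) X (C : (I -> M) -> Prop) h :
  closedD (pow K) C -> splits C h -> acts_as_projections X (pow K) C h ->
  exists B h', [/\ closedD K B, splits B h' & acts_as_projections X K B h'].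
Proof.
move=> cC sC pC.
suff : forall (J : {set I}) C, closedD (pow K) C -> splits C h ->
    acts_as_projections X (pow K) C h ->
    (forall p q, C p -> C q -> forall i, i \notin J -> p i = q i) ->
    exists B h', [/\ closedD K B, splits B h' & acts_as_projections X K B h'].
  by move=> /(_ setT C); apply=> // p q _ _ i; rewrite inE.
move=> {C cC sC pC} J; have [n] := ubnP #|J|; elim: n J => // n IH J le_n.
move=> C cC sC pC CJ.
have [J0|[i iJ]] := set_0Vmem J.
  case: sC => p [q [Cp Cq []]]; congr h; apply: funext => i.
  by apply: CJ => //; rewrite J0 inE.
have [[r [s [Cr Cs rs hrs]]]|coord] := pselect (exists r s,
    [/\ C r, C s, r i = s i & h r <> h s]).
  apply: (IH (J :\ i) _ (fun p => C p /\ p i = r i)).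
  - by move: le_n; rewrite (cardsD1 i J) iJ.
  - move=> Y t v Dt Cv; split; first by apply: cC => // y; case: (Cv y).
    rewrite tev_pow -[RHS](tev_idem (J := K) (r i) t) //.
    by congr (tev _ _ _); apply: funext => y; case: (Cv y).
  - by exists r, s.
  - by move=> t /pC[x xP]; exists x => v Cv; apply: xP => y; case: (Cv y).
  - move=> p q [Cp pi] [Cq qi] j; rewrite !inE negb_and negbK.
    by case/orP => [/eqP->|]; [rewrite pi qi | exact: CJ].
pose h' m := `[< exists p, [/\ C p, p i = m & h p = true] >].
have h'E p : C p -> h' (p i) = h p.
  move=> Cp; apply/asboolP/idP => [[q [Cq qp hq]]|hp]; last by exists p.
  by apply: contrapT => hp; apply: coord; exists p, q; split=> //; rewrite hq.
exists (fun m => exists p, C p /\ p i = m), h'; split.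
- move=> Y t v Dt /fin_choice[p pP]; exists (tev (pow K) p t); split.
    by apply: cC => // y; case: (pP y).
  by rewrite tev_pow; congr (tev _ _ _); apply: funext => y; case: (pP y).
- case: sC => p [q [Cp Cq hpq]]; exists (p i), (q i).
  by rewrite !h'E //; split=> //; [exists p | exists q].
move=> t Dt; have [x xP] := pC t Dt; exists x => v /fin_choice[p pP].
have vE : v = (fun y => p y i) by apply: funext => y; case: (pP y).
rewrite vE -tev_pow h'E; last by apply: cC => // y; case: (pP y).
rewrite h'E; last by case: (pP x).
by apply: xP => y; case: (pP y).
Qed.

Lemma nonTaylor_projections (X : finType) (x0 : X) :
  exists B h, [/\ closedD K B, splits B h & acts_as_projections X K B h].
Proof.
have [C [h [cC sC pC]]] := binary_part_projections x0.
exact: project_projections pC.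
Qed.

(** A term in the variables [Y] becomes one in [X] through [s]. The variable selected lies in the
    image of [s], since otherwise changing it alone would change the value under [h]. *)
Lemma acts_as_projections_inj (X Y : Type) (s : Y -> X) (y0 : Y) B h :
  injective s -> splits B h ->
  acts_as_projections X K B h -> acts_as_projections Y K B h.
Proof.
move=> sI [p [q [Bp Bq hpq]]] pX t Dt.
have [|x xP] := pX (tsub (fun y => Var (s y)) t); first by apply: D_sub.
have tE v : (forall z, B (v z)) -> h (tev K (v \o s) t) = h (v x).
  by move=> Bv; rewrite -xP // tev_sub.
have [[y yx]|nx] := pselect (exists y, s y = x); last first.
  pose v z := if `[< z = x >] then q else p.
  have vx : v x = q by rewrite /v asboolT.
  case: hpq; rewrite -vx -tE; last by rewrite /v => z; case: asboolP.
  rewrite -[LHS](tE (fun=> p)) //; congr (h (tev _ _ _)); apply: funext => y /=.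
  by rewrite /v; case: asboolP => // sx; case: nx; exists y.
have [r rE] : exists r : X -> Y, cancel s r.
  have /fin_choice[r rE] : forall x, exists y, (exists y', s y' = x) -> s y = x.
    move=> x'; have [[y' <-]|nx'] := pselect (exists y', s y' = x');
      first by exists y'.
    by exists y0 => /nx'.
  by exists r => y'; apply: sI; apply: rE; exists y'.
exists y => v Bv; have := tE (v \o r) (fun z => Bv _).
rewrite -yx /= rE => <-; congr (h (tev _ _ _)); apply: funext => z.
by rewrite /= rE.
Qed.

End NonTaylor.
(** Every term in [t] acts under [h] as its leaf. Identities of [K] hold in [L], so testing with [p]
    at one leaf and [q] elsewhere shows that both sides have the same leaf. *)
Lemma projection_nonTaylor S M Q (K : ops S M) (L : ops S Q) n (t : term S 'I_n)
    i (C : Q -> Prop) (h : Q -> bool) :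
  (forall m (e1 e2 : term S 'I_m), (forall v, tev K v e1 = tev K v e2) ->
     forall v, tev L v e1 = tev L v e2) ->
  inv1 L C -> splits C h ->
  (forall v, (forall j, C (v j)) -> h (tev L v t) = h (v i)) ->
  ~ taylor_op (term_fun K t).
Proof.
move=> KL iC [p [q [Cp Cq hpq]]] ht /taylor_leaf/(_ i)[m [e1 [e2 [e12 nl]]]].
pose v z := if z == leaf i e1 then p else q.
have Cv z : C (v z) by rewrite /v; case: eqP.
have hE e : h (tev L v (expand t e)) = h (v (leaf i e)).
  elim: e => //= o es IH; rewrite tev_sub ht ?IH // => j.
  exact: inv1_tev.
have {}e12 : tev L v (expand t e1) = tev L v (expand t e2).
  by apply: KL => w; rewrite -!eval_expand.
apply: hpq; have := hE e1; rewrite e12 hE /v eqxx => <-.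
by case: eqP => // /esym.
Qed.

(** * Taylor terms preserving a majority pair *)

Section Preserve.
Variables (S : signature) (A : finType) (J : ops S A) (E : A -> A -> Prop).
Arguments J : clear implicits.
Hypothesis H : split_algebra J E.
Hypothesis full : full_orders J E.
Hypothesis nolatin : forall f, ~ latin J f.
Variables (M : finType) (K : ops S M).
Arguments K : clear implicits.
Hypothesis iK : idem K.
Variables (a b : A) (maj : term S 'I_3).
Hypothesis ab : ~ E a b.
Hypothesis majP : [/\ tev J (v3 a a b) maj = a, tev J (v3 a b a) maj = a
  & tev J (v3 b a a) maj = a].

Let iJ := split_idem H.
Let nab := split_neqx H ab.

Definition preserves (X : Type) (t : term S X) :=
  forall v : X -> A, (forall x, v x = a \/ v x = b) ->
    tev J v t = a \/ tev J v t = b.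

Lemma preserves_var X (x : X) : preserves (Var x).
Proof. by move=> v; exact. Qed.

Lemma preserves_sub X Y (s : X -> term S Y) t :
  preserves t -> (forall x, preserves (s x)) -> preserves (tsub s t).
Proof. by move=> Dt Ds v vab; rewrite tev_sub; apply: Dt => x; apply: Ds. Qed.

Lemma swap_ab X (t : term S X) (v v' : X -> A) :
  (forall x, v x = a /\ v' x = b \/ v x = b /\ v' x = a) ->
  (tev J v t = a <-> tev J v' t = b) /\ (tev J v t = b <-> tev J v' t = a).
Proof.
move=> vv'; have [s [hs sa sb sK]] := split_swap H ab.
have -> : v' = s \o v by apply: funext => x /=; case: (vv' x) => -[-> ->].
rewrite -(tev_hom _ _ hs); split; split=> [->//|].
  by rewrite -[in RHS]sa => /(congr1 s); rewrite !sK.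
by rewrite -[in RHS]sb => /(congr1 s); rewrite !sK.
Qed.

Lemma preserves2 (t : term S bool) :
  tev J (v2 a b) t = a \/ tev J (v2 a b) t = b -> preserves t.
Proof.
move=> tab v vab; have -> : v = v2 (v true) (v false) by apply: funext; case.
have v2xx x : v2 x x = fun=> x :> A by apply: funext; case.
have [sab sba] : (tev J (v2 a b) t = a <-> tev J (v2 b a) t = b) /\
    (tev J (v2 a b) t = b <-> tev J (v2 b a) t = a).
  by apply: swap_ab; case; [left | right].
case: (vab true) => ->; case: (vab false) => ->; rewrite ?v2xx ?tev_idem //.
- by left.
- by case: tab => [/sab|/sba]; [right | left].
- by right.
Qed.

(** Up to the automorphism exchanging [a] and [b], these are the only nonconstant triples over
    [{a, b}]. *)
Lemma preserves3 (t : term S 'I_3) :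
  tev J (v3 a a b) t = a \/ tev J (v3 a a b) t = b ->
  tev J (v3 a b a) t = a \/ tev J (v3 a b a) t = b ->
  tev J (v3 b a a) t = a \/ tev J (v3 b a a) t = b -> preserves t.
Proof.
move=> t1 t2 t3 v vab.
have -> : v = v3 (v ord0) (v (Ordinal (isT : 1 < 3))) (v ord_max).
  apply: funext => -[[|[|[|]]]] // i; rewrite /v3 (tnth_nth a) /=;
    by congr v; apply: val_inj.
have v3xx x : v3 x x x = fun=> x :> A by apply: funext => -[[|[|[|]]]].
have sw x y z x' y' z' : x = a /\ x' = b \/ x = b /\ x' = a ->
    y = a /\ y' = b \/ y = b /\ y' = a -> z = a /\ z' = b \/ z = b /\ z' = a ->
    tev J (v3 x y z) t = a \/ tev J (v3 x y z) t = b ->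
    tev J (v3 x' y' z') t = a \/ tev J (v3 x' y' z') t = b.
  move=> xx yy zz; have [] := @swap_ab _ t (v3 x y z) (v3 x' y' z').
    by case=> [[|[|[|]]]] // i; rewrite /v3 !(tnth_nth a).
  by move=> s1 s2 [/s1|/s2]; [right | left].
case: (vab ord0) => ->; case: (vab (Ordinal (isT : 1 < 3))) => ->;
  case: (vab ord_max) => -> //;
  rewrite ?v3xx ?tev_idem //; try (by left); try (by right).
- by apply: (sw b a a); [right | left | left |].
- by apply: (sw a b a); [left | right | left |].
- by apply: (sw a a b); [left | left | right |].
Qed.

Lemma preserves_maj : preserves maj.
Proof. by case: majP => m1 m2 m3; apply: preserves3; left. Qed.

(** [maj] acts under [h] as some projection [i]. Putting the second variable in place [i] and the
    first in the two others gives the first variable on [{a, b}] and, under [h], the second. *)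
Lemma maj_avoids (B : M -> Prop) (h : M -> bool) x y :
  acts_as_projections preserves 'I_3 K B h -> B x -> B y -> h x <> h y ->
  exists t : term S bool,
    [/\ tev J (v2 a b) t = a, tev J (v2 b a) t = b & h (tev K (v2 x y) t)
      <> h x].
Proof.
move=> pB Bx By hxy; apply: contrapT => nt; have [i iP] := pB _ preserves_maj.
have [m1 m2 m3] := majP.
have hm r : tev J (v2 a b \o r) maj = a -> h (tev K (v2 x y \o r) maj) = h x.
  move=> tab; apply: contrapT => nh; apply: nt; exists (tsub (Var \o r) maj).
  rewrite !tev_sub; split=> //.
  have [] := @swap_ab _ maj (v2 a b \o r) (v2 b a \o r); last by move=> s1 _;
    apply/s1.
  by move=> j /=; case: (r j); [left | right].
apply: hxy; pose i1 := Ordinal (isT : 1 < 3).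
have {hm} : h (tev K (v2 x y \o (fun j => j != i)) maj) = h x.
  apply: hm; case: i {iP} => [[|[|[|]]]] // i;
    [rewrite -m3 | rewrite -m2 | rewrite -m1]; congr (tev _ _ _);
    by apply: funext => -[[|[|[|]]]].
by rewrite iP /= ?eqxx // => j; case: (_ != _).
Qed.

(** * Correcting terms when the preserving terms act as projections *)

Section Projections.
Variables (B : M -> Prop) (h : M -> bool) (n0 : nat).
Hypothesis cB : closedD preserves K B.
Hypothesis sB : splits B h.
Hypothesis pB : acts_as_projections preserves 'I_3 K B h.

(** [B] is closed only under the terms preserving [{a, b}],
  [P] under all terms. *)
Lemma minimal_split_subuniverse : exists P : M -> Prop,
  [/\ inv1 K P, forall p, P p -> B p, splits P h
    & forall x y, P x -> P y -> h x <> h y ->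
        forall Q : M -> Prop, inv1 K Q -> Q x -> Q y -> forall p, P p -> Q p].
Proof.
pose good (P : {set M}) := [/\ inv1 K (fun p => p \in P),
  forall p, p \in P -> B p & splits (fun p => p \in P) h].
have [P0 gP0] : exists P, good P.
  have [x [y [Bx By hxy]]] := sB.
  have [t [tab _ ht]] := maj_avoids pB Bx By hxy.
  (* As the section at [a] of a generated relation, [Q] is closed under all terms; it lies in [B]
     because a binary term with [a] as value at [(a, b)] preserves [{a, b}]. *)
  pose Q p := exists t, tev J (v2 a b) t = a /\ tev K (v2 x y) t = p.
  exists [set p | `[< Q p >]]; split=> [o u uP|p|].
  - rewrite inE; apply/asboolP.
    apply: (inv2_section iJ (inv2_gen J K (v2 a b) (v2 x y))) => j.
    by have := uP j; rewrite inE => /asboolP.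
  - rewrite inE => /asboolP[u [uab <-]]; apply: cB; last by case.
    by apply: preserves2; left.
  - exists (tev K (v2 x y) t), x; split=> //; rewrite inE; apply/asboolP.
      by exists t.
    by exists (Var true).
have [|P /minsetP[/asboolP[P1 P2 P3] Pmin]] :=
  @ex_minset _ [pred P | `[< good P >]].
  by exists P0; apply/asboolP.
exists (fun p => p \in P); split=> // x y xP yP hxy Q iQ Qx Qy p pP.
suff /setP/(_ p) : [set p in P | `[< Q p >]] = P.
  by rewrite inE pP /= => /asboolP.
apply: Pmin; last by apply/subsetP => q; rewrite inE => /andP[].
apply/asboolP; split=> [o u uP|q|].
- rewrite inE P1 /=; last by move=> j; have := uP j; rewrite inE => /andP[].
  by apply/asboolP/iQ => j; have := uP j; rewrite inE => /andP[_ /asboolP].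
- by rewrite inE => /andP[/P2].
- by exists x, y; rewrite !inE xP yP; split=> //; apply/asboolP.
Qed.

Variable P : M -> Prop.
Hypothesis iP : inv1 K P.
Hypothesis PB : forall p, P p -> B p.
Hypothesis sP : splits P h.
Hypothesis Pgen : forall x y, P x -> P y -> h x <> h y ->
  forall Q : M -> Prop, inv1 K Q -> Q x -> Q y -> forall p, P p -> Q p.

Lemma minimal_term X (t : term S X) v : (forall x, P (v x)) -> P (tev K v t).
Proof. exact: inv1_tev. Qed.

Lemma minimal_v2 x y t : P x -> P y -> P (tev K (v2 x y) t).
Proof. by move=> Px Py; apply: minimal_term; case. Qed.

(** The values at [(x, y)] of the terms with value [c] at [(u, v)] form a subuniverse; it contains
    [p] and [q], so all of [P]. *)
Lemma minimal_reach u v c x y p q r : P x -> P y -> h p <> h q ->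
  (exists t, tev K (v2 x y) t = p /\ tev J (v2 u v) t = c) ->
  (exists t, tev K (v2 x y) t = q /\ tev J (v2 u v) t = c) -> P r ->
  exists t, tev K (v2 x y) t = r /\ tev J (v2 u v) t = c.
Proof.
move=> Px Py hpq pc qc; move: r; apply: (Pgen _ _ hpq) => //.
- by case: pc => t [<- _]; exact: minimal_v2.
- by case: qc => t [<- _]; exact: minimal_v2.
- exact: (inv2_section iJ (inv2_sym (inv2_gen K J (v2 x y) (v2 u v)))).
Qed.

Lemma minimal_flip x y : P x -> P y -> h x <> h y ->
  exists t, tev K (v2 x y) t = y /\ tev J (v2 b a) t = b.
Proof.
move=> Px Py hxy; have [t [_ tb ht]] := maj_avoids pB (PB Px) (PB Py) hxy.
apply: (minimal_reach Px Py (p := x) (q := tev K (v2 x y) t)) => //.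
- by move=> xt; apply: ht.
- by exists (Var true).
- by exists t.
Qed.

Let i1 := Ordinal (isT : 1 < 3).
Let i2 := Ordinal (isT : 2 < 3).

(** A preserving [G] acts under [h] as a projection, and the triple [(x, y, y)] shows that it is the
    first one. *)
Lemma corrector_spec u (G : term S 'I_3) x y :
  [/\ tev J (v3 a a b) G = a,
    tev J (v3 a b a) G = a & tev J (v3 b a a) G = b] ->
  tev J (v3 u a b) G = a \/ tev J (v3 u a b) G = b ->
  P x -> P y -> h x <> h y -> h (tev K (v3 x y y) G) = h x ->
  [/\ preserves G, tev J (v3 u a b) G = a \/ tev J (v3 u a b) G = b
    & forall v, (forall j, P (v j)) -> h (tev K v G) = h (v ord0)].
Proof.
move=> [G1 G2 G3] Gu Px Py hxy hG.
have DG : preserves G by apply: preserves3; [left | left | right].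
split=> // v Pv; have [i hi] := pB DG; rewrite hi; last by move=> j; exact: PB.
have := hi (v3 x y y); rewrite hG; case: i {hi} => [[|[|[|]]]] // i /=.
- by move=> _; congr (h (v _)); apply: val_inj.
- by move/(_ _)/hxy => []; case=> [[|[|[|]]]] // ?; exact: PB.
- by move/(_ _)/hxy => []; case=> [[|[|[|]]]] // ?; exact: PB.
Qed.

Lemma sep_var (p q : 'I_3 -> A) i j :
  p i = p j -> q i <> q j -> separates J p q \/ separates J q p.
Proof. by move=> pij qij; left; exists (Var i), (Var j). Qed.

Lemma sepC (p q : 'I_3 -> A) :
  separates J p q \/ separates J q p -> separates J q p \/ separates J p q.
Proof. by case; [right | left]. Qed.

(** The first row is the one to be moved into [{a, b}]; the other three control preservation, by
    [preserves3]. *)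
Definition rows u := [:: v3 u a b; v3 a a b; v3 a b a; v3 b a a].

Lemma rows_gen u s : s < 4 ->
  exists i j, ~ E (nth (v3 u a b) (rows u) s i) (nth (v3 u a b) (rows u) s j).
Proof.
by case: s => [|[|[|[|]]]] //= _;
  [exists i1, i2 | exists i1, i2 | exists ord0, i1 | exists i1, ord0] => //;
  rewrite /v3 !(tnth_nth a) //=; apply: split_nsym.
Qed.

Lemma rows_sep u s s' : u <> a -> u <> b -> s < 4 -> s' < 4 -> s != s' ->
  let r := nth (v3 u a b) (rows u) in
  separates J (r s) (r s') \/ separates J (r s') (r s).
Proof.
have ba : b <> a by move/esym.
move=> ua ub; wlog : s s' / s < s'.
  move=> W s4 s'4 ss' r; case: (ltngtP s s') ss' => // [lt|gt] _.
    by apply: W => //; rewrite ltn_eqF.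
  by apply: sepC; apply: W => //; rewrite ltn_eqF.
case: s => [|[|[|s]]]; case: s' => [|[|[|[|s']]]] //= _ _ _ _; apply: sepC.
- by apply: (@sep_var _ _ ord0 i1).
- by apply: (@sep_var _ _ ord0 i2).
- by apply: (@sep_var _ _ i1 i2).
- by apply: (@sep_var _ _ ord0 i2).
- by apply: (@sep_var _ _ i1 i2).
- by apply: (@sep_var _ _ i1 i2).
Qed.

(** The rows are sent to [v, a, a, b], where [v] in [{a, b}] is far from [u]. Besides this, the
    value at [(x, y, y)] must lie in the block of [x]. *)
Lemma corrector u : u <> a -> u <> b -> exists G : term S 'I_3,
  [/\ preserves G, tev J (v3 u a b) G = a \/ tev J (v3 u a b) G = b
    & forall v, (forall j, P (v j)) -> h (tev K v G) = h (v ord0)].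
Proof.
move=> ua ub; have [x [y [Px Py hxy]]] := sP.
have [v [vab uv]] : exists v, (v = a \/ v = b) /\ ~ E u v.
  by case: (split_not_both H u ab) => ?; [exists a | exists b]; split=> //;
    [left | right].
have nuv := split_neqx H uv.
have Pxyy z w t : P z -> P w -> P (tev K (v3 z w w) t).
  by move=> Pz Pw; apply: minimal_term; case=> [[|[|[|]]]].
pose r := nth (v3 u a b) (rows u).
have [fO|nfO] := pselect (forall t t', tev K (v2 x y) t = tev K (v2 x y) t' ->
    tev J (v2 u v) t = tev J (v2 u v) t').
  pose r5 (s : 'I_5) := if s < 4 then r s else v3 u v v.
  (* Here the value at [(x, y)] determines that at [(u, v)]. The fifth row [(u, v, v)] gets the
     default [u] as target, which keeps [G] at [(x, y, y)] in the block of [x]: otherwise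
     [minimal_reach] gives a term with values [y] and [u], although the second variable has values
     [y] and [v]. *)
  pose w5 (s : 'I_5) := nth u [:: v; a; a; b] s.
  have [t' [t'y t'b]] := minimal_flip Px Py hxy.
  have [] := @rows_full _ _ _ _ H full nolatin 'I_5 'I_3 r5 ord0 _ _ w5.
  - move=> s; rewrite /r5; case: ifP => [s4|_]; first exact: rows_gen.
    by exists ord0, i1; exact: uv.
  - move=> s s'; wlog : s s' / s < s'.
      move=> W ss'; case: (ltngtP s s') => [lt|gt|/val_inj eq].
      + exact: W.
      + by apply: sepC; apply: W; rewrite // eq_sym.
      + by rewrite eq eqxx in ss'.
    move=> ss' nss'; rewrite /r5; have s4 : s < 4 by have := ltn_ord s';
      rewrite ltnS; exact: leq_trans ss'.
    rewrite s4; case: ifP => [s'4|_]; first exact: rows_sep.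
    case: s ss' nss' s4 => [[|[|[|[|]]]]] //= ? _ _ _; apply: sepC.
    + by apply: (@sep_var _ _ i1 i2).
    + by apply: (@sep_var _ _ i1 i2).
    + by apply: (@sep_var _ _ i1 i2) => //= /esym.
    left; exists (tsub (v2 (Var ord0) (Var i1)) t'), (Var i1); rewrite !tev_sub.
    have e c d : (fun z => tev J (v3 c d d) (v2 (Var ord0) (Var i1) z))
      = v2 c d.
      by apply: funext; case.
    rewrite !e t'b; split; last by move/esym.
    exact: (fO t' (Var false)).
  move=> G GE; exists G.
  have Gu := GE ord0; have G1 := GE (inord 1); have G2 := GE (inord 2).
  have G3 := GE (inord 3); have G4 := GE ord_max.
  move: Gu G1 G2 G3 G4; rewrite /r5 /w5 !inordK //= => Gu G1 G2 G3 G4.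
  apply: (corrector_spec (x := x) (y := y)) => //; first by rewrite Gu.
  apply: contrapT => nh.
  have [||t [ty tu]] := minimal_reach (u := u) (v := v) (c := u) (r := y)
    (p := tev K (v3 x y y) G) Px Py nh _ _ Py.
  + exists (tsub (v3 (Var true) (Var false) (Var false)) G); rewrite !tev_sub.
    by rewrite -G4; split; congr (tev _ _ _); apply: funext => -[[|[|[|]]]].
  + by exists (Var true).
  by apply: nuv; rewrite -tu (fO t (Var false)).
have [z zR] : exists z, forall c, exists t,
    tev K (v2 x y) t = z /\ tev J (v2 u v) t = c.
  apply: (full_section H iK (inv2_gen K J (v2 x y) (v2 u v))) => [c|].
    by have [t tE] := split_term H c uv; exists (tev K (v2 x y) t), t.
  apply: contrapT => nR; apply: nfO => t t' tt'; apply: contrapT => ntt'.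
  by apply: nR; exists (tev K (v2 x y) t), (tev J (v2 u v) t),
    (tev J (v2 u v) t'); split=> //; [exists t | exists t'].
(* [k] keeps the first argument at [(x', y')] but the second at [(u, v)]. If [z] is not in the block
   of [x], then [x] and [y] change roles and the automorphism exchanging [u] and [v] is used. *)
have {nfO zR} [x' [y' [Px' Py' hxy' [k [kx kv]]]]] : exists x' y',
    [/\ P x', P y', h x' <> h y'
      & exists k, tev K (v2 x' y') k = x' /\ tev J (v2 u v) k = v].
  have [hzx|hzx] := pselect (h z = h x).
    exists x, y; split=> //.
    apply: (minimal_reach (p := z) (q := y)) => //; first by rewrite hzx.
    by exists (Var false).
  exists y, x; split=> //; first by move/esym.
  have [|t [ty tu]] := minimal_reach (p := z) (q := x) Px Py hzx (zR u) _ Py.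
    by exists (Var true).
  have [s [hs su sv _]] := split_swap H uv.
  exists (tsub (v2 (Var false) (Var true)) t); rewrite !tev_sub.
  split; first by rewrite -[RHS]ty; congr (tev _ _ _); apply: funext; case.
  rewrite -su -[in RHS]tu (tev_hom _ _ hs); congr (tev _ _ _).
  by apply: funext; case.
clear x y Px Py hxy z; rename x' into x, y' into y, Px' into Px, Py' into Py.
have hxy := hxy'.
pose r4 (s : 'I_4) := r s.
have r4_full w : exists t, forall s, tev J (r4 s) t = w s.
  apply: (@rows_full _ _ _ _ H full nolatin 'I_4 'I_3 r4 ord0).
    by move=> s; exact: rows_gen.
  by move=> s s' ss'; exact: rows_sep.
pose F (w : 'I_4 -> A) p := exists t,
  tev (pow J) (fun i s => r4 s i) t = w /\ tev K (v3 x y y) t = p.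
have iF : inv2 (pow J) K F by exact: inv2_gen.
have Fvar i : F (fun s => r4 s i) (v3 x y y i) by exists (Var i).
(* The second and third variables are both [y] at [(x, y, y)] and differ in the first three rows;
   for the last row, [minimal_flip] supplies the other tuple. *)
have [p Fp] : exists p, forall w, F w p.
  apply: (full_fibre H full nolatin iF) => [w|].
    have [t tE] := r4_full w; exists (tev K (v3 x y y) t), t; split=> //.
    by apply: funext => s; rewrite tev_pow.
  case=> [[|[|[|[|]]]]] // i.
  - by exists y, (fun s => r4 s i1), (fun s => r4 s i2); split;
    [exact: (Fvar i1) | exact: (Fvar i2) | exact: nab].
  - by exists y, (fun s => r4 s i1), (fun s => r4 s i2); split;
    [exact: (Fvar i1) | exact: (Fvar i2) | exact: nab].
  - by exists y, (fun s => r4 s i1), (fun s => r4 s i2); split;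
    [exact: (Fvar i1) | exact: (Fvar i2) | move/esym].
  have [t [ty tb]] := minimal_flip Px Py hxy.
  pose t3 := tsub (v2 (Var ord0) (Var i1)) t.
  exists y, (tev (pow J) (fun i s => r4 s i) t3), (fun s => r4 s i1); split.
  - exists t3; split=> //; rewrite tev_sub -[RHS]ty.
    by congr (tev _ _ _); apply: funext; case.
  - exact: (Fvar i1).
  rewrite tev_pow tev_sub (_ : (fun z => _) = v2 b a) ?tb; last first.
    by apply: funext; case.
  by move/esym.
have [_ [t0 [_ t0p]]] : exists w, F w p by exists (fun=> a).
have Pp : P p by rewrite -t0p; exact: Pxyy.
pose w (s : 'I_4) := nth u [:: v; a; a; b] s.
have wE (t : term S 'I_3) : tev (pow J) (fun i s => r4 s i) t = w ->
    [/\ tev J (v3 a a b) t = a, tev J (v3 a b a) t = a & tev J (v3 b a a) t = b]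
    /\ tev J (v3 u a b) t = v.
  move=> tw; have tE s : tev J (r4 s) t = w s by rewrite -tw tev_pow.
  have := (tE ord0, tE (inord 1), tE (inord 2), tE (inord 3)).
  by rewrite /r4 /w !inordK //= => -[[[-> -> ] ->] ->].
have [hpx|hpx] := pselect (h p = h x).
  have [t [/wE[tw tv] tp]] := Fp w; exists t.
  by apply: (corrector_spec (x := x) (y := y)); rewrite ?tv ?tp.
(* The first column is paired with [p] and [x] in different blocks, hence with [y]. All three
   columns are then paired with [y], and so is [w]. *)
have F0y : F (fun s => r4 s ord0) y.
  exact: (Pgen Pp Px hpx (inv2_section (@idem_pow _ _ _ _ H _) iF)).
have [t tw] := r4_full w.
have [t' [t'w t'y]] : F w y.
  rewrite (_ : w = tev (pow J) (fun i s => r4 s i) t); last first.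
    by apply: funext => s; rewrite tev_pow.
  apply: (inv1_tev _ (inv2_section iK (inv2_sym iF))) => j.
  case: (j =P ord0) => [-> //|j0]; have := Fvar j.
  by case: j j0 => [[|[|[|]]]] // i j0; case: j0; apply: val_inj.
have [[w1 w2 w3] w0] := wE _ t'w.
(* [t'] is right on the rows but gives [y] at [(x, y, y)]. There [k] returns [x]; at the first row
   it returns [v]; on the other rows its two arguments coincide. *)
exists (tsub (v2 (Var ord0) t') k).
have kE c d e : tev J (v3 c d e) (tsub (v2 (Var ord0) t') k) =
    tev J (v2 c (tev J (v3 c d e) t')) k.
  by rewrite tev_sub; congr (tev _ _ _); apply: funext; case.
have v2xx c : v2 c c = fun=> c :> A by apply: funext; case.
apply: (corrector_spec (x := x) (y := y)) => //.
- by rewrite !kE w1 w2 w3 !v2xx !tev_idem.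
- by rewrite kE w0 kv.
by rewrite tev_sub -[in RHS]kx; congr (h (tev _ _ _)); apply: funext; case.
Qed.

(** Correct the values of [t] on [{a, b}] one tuple at a time. *)
Lemma repair (X : finType) (t : term S X) : exists t', preserves t' /\
  forall v, (forall x, P (v x)) -> h (tev K v t') = h (tev K v t).
Proof.
pose ev (w : {ffun X -> bool}) t := tev J (fun x => if w x then a else b) t.
pose ok c := (c == a) || (c == b).
pose bad t := [set w | ~~ ok (ev w t)].
have [n] := ubnP #|bad t|; elim: n t => // n IH t le_n.
have [bad0|[w]] := set_0Vmem (bad t).
  exists t; split=> // v vab; pose w := [ffun x => v x == a].
  have -> : v = fun x => if w x then a else b.
    by apply: funext => x; rewrite ffunE; case: eqP => // va; case: (vab x).
  move/setP/(_ w): bad0; rewrite !inE => /negbFE/orP[]/eqP; by [left | right].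
rewrite inE negb_or => /andP[/eqP wa /eqP wb].
have [i wi] : exists i, w i.
  apply: contrapT => /contra_ex nw; apply: wb; rewrite /ev.
  rewrite (_ : (fun x => _) = fun=> b) ?tev_idem //.
  by apply: funext => x; case: ifP (nw x).
have [j wj] : exists j, ~~ w j.
  apply: contrapT => /contra_ex nw; apply: wa; rewrite /ev.
  rewrite (_ : (fun x => _) = fun=> a) ?tev_idem //.
  by apply: funext => x; case: ifP (nw x) => // _ [].
have [G [DG Gw hG]] := corrector wa wb.
(* [w] assigns [a] to [i] and [b] to [j], so [G] is applied to the triple it corrects. Tuples
   already good stay good because [G] preserves [{a, b}]. *)
pose t' := tsub (v3 t (Var i) (Var j)) G.
have t'E B' (L : ops S B') v :
    tev L v t' = tev L (v3 (tev L v t) (v i) (v j)) G.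
  by rewrite tev_sub; congr (tev _ _ _); apply: funext => -[[|[|[|]]]].
have [|t'' [Dt'' ht'']] := IH t'; last first.
- exists t''; split=> // v Pv; rewrite ht'' // t'E hG //.
  by case=> [[|[|[|]]]] // k; rewrite /v3 (tnth_nth (v i)) //=;
    exact: minimal_term.
rewrite -ltnS; apply: leq_trans le_n; rewrite ltnS.
apply: proper_card; apply/properP; split; last first.
  exists w; rewrite !inE; first by rewrite negb_or; apply/andP; split;
    apply/eqP.
  rewrite negbK /ev t'E wi (negPf wj) /ok; case: Gw => ->;
    by rewrite eqxx ?orbT.
apply/subsetP=> w'; rewrite !inE; apply: contra => /orP okw'.
have := DG (v3 (ev w' t) (if w' i then a else b) (if w' j then a else b)).
rewrite [ev w' t']/ev t'E /ok => /(_ _)[].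
- case=> [[|[|[|]]]] // k; rewrite /v3 (tnth_nth a) /=.
  + by case: okw' => /eqP; [left | right].
  + by case: (w' i); [left | right].
  + by case: (w' j); [left | right].
- by move=> ->; rewrite eqxx.
- by move=> ->; rewrite eqxx orbT.
Qed.

End Projections.

(** Otherwise the preserving terms act as projections on some [B] under [h]. Then [repair] makes
    [t0] agree under [h] on [P] with such a term, so [t0] is not Taylor. *)
Lemma preserving_taylor n0 (t0 : term S 'I_n0) : taylor_op (term_fun K t0) ->
  exists n (t : term S 'I_n), preserves t /\ taylor_op (term_fun K t).
Proof.
move=> T0; apply: contrapT => nT.
(* The sum of arities provides a single [B] and [h] for both [t0] and [maj]. *)
have [|B [h [cB sB pB]]] := @nonTaylor_projections _ _ K iK preserves
  preserves_var (@preserves_sub) _ ('I_n0 + 'I_3)%type (inr ord0).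
  by move=> n t Dt Tt; apply: nT; exists n, t.
have pB3 : acts_as_projections preserves 'I_3 K B h.
  by apply: (acts_as_projections_inj preserves_var (@preserves_sub) (s := inr)
    ord0 _ sB pB) => i j [].
have [P [iP PB sP Pgen]] := minimal_split_subuniverse cB sB pB3.
have [j0] : exists j : 'I_n0, True.
  case: n0 t0 T0 {pB} => [|n] t0 [T0 _]; last by exists ord0.
  case: sB => p [q [_ _ []]]; rewrite -(T0 p) -(T0 q).
  by congr (h (term_fun _ _ _)); apply: val_inj.
move=> _.
have pB0 : acts_as_projections preserves 'I_n0 K B h.
  by apply: (acts_as_projections_inj preserves_var (@preserves_sub) (s := inl)
    j0 _ sB pB) => i j [].
have [t' [Dt' ht']] := repair pB3 iP PB sP Pgen t0.
have [i hi] := pB0 t' Dt'.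
apply: (@projection_nonTaylor _ _ _ K K _ t0 i P h) => // v Pv.
by rewrite -ht' // hi // => j; exact: PB.
Qed.

End Preserve.
(** * The pseudovariety *)

Section Algebras.
Variable S : signature.
Implicit Types A B M : algebra S.

Lemma map_mktuple X Y n (f : X -> Y) (u : 'I_n -> X) :
  map_tuple f [tuple u j | j < n] = [tuple f (u j) | j < n].
Proof. by apply: eq_from_tnth => j; rewrite tnth_map !tnth_mktuple. Qed.

Lemma mktuple_tnth X n (v : n.-tuple X) : [tuple tnth v j | j < n] = v.
Proof. by apply: eq_from_tnth => j; rewrite tnth_mktuple. Qed.

Lemma tnth_mktuple_fun X n (u : 'I_n -> X) : tnth [tuple u j | j < n] = u.
Proof. by apply: funext => j; rewrite tnth_mktuple. Qed.

Lemma hom_alg A B (f : A -> B) :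
  homomorphism f -> hom (alg_ops A) (alg_ops B) f.
Proof. by move=> hf o u; rewrite /alg_ops hf map_mktuple. Qed.

Lemma alg_hom A B (f : A -> B) :
  hom (alg_ops A) (alg_ops B) f -> homomorphism f.
Proof.
move=> hf o v; have := hf o (tnth v); rewrite /alg_ops mktuple_tnth => ->.
by congr (interp B o _); apply: eq_from_tnth => j;
  rewrite tnth_mktuple tnth_map.
Qed.

Lemma subuniverse_inv1 A (B : {set A}) :
  subuniverse B -> inv1 (alg_ops A) (fun x => x \in B).
Proof. by move=> cB o u uB; apply: cB => _ /mapP[j _ ->]. Qed.

Lemma inv1_subuniverse A (B : {set A}) :
  inv1 (alg_ops A) (fun x => x \in B) -> subuniverse B.
Proof.
move=> cB o v vB; rewrite -(mktuple_tnth v); apply: cB => j.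
by apply: vB; exact: mem_tnth.
Qed.

Lemma sub_val_hom A (B : subalgebra A) :
  homomorphism (val : sub_alg B -> A).
Proof. by []. Qed.

Lemma coordinate_hom A n (i : 'I_n) :
  homomorphism ((fun g => g i) : power_alg A n -> A).
Proof. by move=> o v; rewrite /= ffunE. Qed.

Lemma HSP_identity M A X (t1 t2 : term S X) : HSPfin M A ->
  (forall v, tev (alg_ops M) v t1 = tev (alg_ops M) v t2) ->
  forall v, tev (alg_ops A) v t1 = tev (alg_ops A) v t2.
Proof.
case=> n [R [f [/hom_alg hf f_onto]]] t12 v.
have /fin_choice[r rE] : forall x, exists r, f r = v x by move=> x;
  exact: f_onto.
have -> : v = f \o r by apply: funext => x; rewrite /= rE.
rewrite -!(tev_hom _ _ hf); congr (f _); apply: val_inj; apply/ffunP => i.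
pose pr (g : sub_alg R) : M := (val g : {ffun 'I_n -> M}) i.
have hv : hom (alg_ops (sub_alg R)) (alg_ops M) pr.
  apply: (@hom_comp _ _ _ _ _ (alg_ops (power_alg M n))
    _ val (fun g : {ffun 'I_n -> M} => g i)).
    exact: hom_alg (@sub_val_hom _ R).
  exact: hom_alg (coordinate_hom i).
by have := t12 (pr \o r); rewrite -!(tev_hom _ _ hv).
Qed.

Lemma idempotent_idem A : idempotent_alg A -> idem (alg_ops A).
Proof.
move=> iA o x; rewrite -[RHS](iA o x) /alg_ops; congr (interp A o _).
by apply: eq_from_tnth => j; rewrite tnth_mktuple (tnth_nth x) nth_nseq ltn_ord.
Qed.

Lemma HSP_idem M A : idempotent_alg M -> HSPfin M A -> idem (alg_ops A).
Proof.
move=> /idempotent_idem iM MA o x.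
apply: (HSP_identity (t1 := App (o := o) (fun=> Var tt)) (t2 := Var tt)
  MA _ (fun=> x)).
by move=> v /=; rewrite iM.
Qed.

Lemma HSP_quotient M A B (f : A -> B) : HSPfin M A -> homomorphism f ->
  (forall b, exists a, f a = b) -> HSPfin M B.
Proof.
case=> n [R [g [hg g_onto]]] hf f_onto; exists n, R, (f \o g); split.
  exact/alg_hom/(hom_comp (hom_alg hg) (hom_alg hf)).
by move=> b; have [a <-] := f_onto b; have [r <-] := g_onto a; exists r.
Qed.

(** The preimage of [B] in the subalgebra of the power maps onto [B]. *)
Lemma HSP_sub M A (B : subalgebra A) : HSPfin M A -> HSPfin M (sub_alg B).
Proof.
case=> n [R [f [hf f_onto]]].
pose P (g : {ffun 'I_n -> M}) := exists r : sub_alg R,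
  val r = g /\ f r \in sub_set B.
pose R' : {set power_alg M n} := [set g | `[< P g >]].
have R'P g : g \in R' -> P g by rewrite inE => /asboolP.
have cR' : subuniverse R'.
  apply: inv1_subuniverse => o u uR'; rewrite inE; apply/asboolP.
  have /fin_choice[r rE] : forall j, P (u j) by move=> j; apply: R'P.
  exists (alg_ops (sub_alg R) o r); split.
    rewrite (hom_alg (@sub_val_hom _ R)).
    by congr (alg_ops _ _ _); apply: funext => j; case: (rE j).
  rewrite (hom_alg hf).
  by apply: (subuniverse_inv1 (@sub_closed _ _ B)) => j; case: (rE j).
have nR' : R' != set0.
  have /set0Pn[b bB] := sub_neq0 B; have [r rb] := f_onto b.
  by apply/set0Pn; exists (val r); rewrite inE; apply/asboolP; exists r;
    rewrite rb.
pose Q := Subalgebra cR' nR'.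
have /fin_choice[g gE] : forall q : sub_alg Q, exists b : sub_alg B,
    exists r : sub_alg R, val r = val q /\ f r = val b.
  move=> q; have [r [rq frB]] := R'P _ (valP q).
  by exists (exist _ (f r) frB), r.
have gval q (r : sub_alg R) : val r = val q -> val (g q) = f r.
  move=> rq; have [r' [r'q <-]] := gE q; congr f.
  by apply: val_inj; rewrite rq r'q.
exists n, Q, g; split.
  apply: alg_hom => o u; apply: val_inj.
  have /fin_choice[r rE] : forall j, exists r : sub_alg R,
    val r = val (u j) /\ f r = val (g (u j)).
    by move=> j; exact: gE.
  rewrite (gval _ (alg_ops (sub_alg R) o r)).
    rewrite (hom_alg hf).
    rewrite (hom_alg (@sub_val_hom _ B)).
    by congr (alg_ops _ _ _); apply: funext => j; case: (rE j).
  rewrite (hom_alg (@sub_val_hom _ R)).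
  rewrite (hom_alg (@sub_val_hom _ Q)).
  by congr (alg_ops _ _ _); apply: funext => j; case: (rE j).
move=> b; have [r rb] := f_onto (val b).
have rQ : val r \in sub_set Q.
  by rewrite inE; apply/asboolP; exists r; rewrite rb; split=> //; exact: valP.
exists (exist _ (val r) rQ); apply: val_inj.
by rewrite (gval _ r).
Qed.

(** The quotient lives on canonical representatives; equivalent elements define the same predicate,
    so [pick] gives them the same representative. *)
Lemma quotient_exists A (T : A -> A -> Prop) :
  (forall x, T x x) -> (forall x y, T x y -> T y x) ->
  (forall x y z, T x y -> T y z -> T x z) -> inv2 (alg_ops A) (alg_ops A) T ->
  exists (Q : algebra S) (f : A -> Q), [/\ homomorphism f,
    forall q, exists a, f a = q, forall x y, f x = f y <-> T x y
    & (exists x y, T x y /\ x <> y) -> #|Q| < #|A|].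
Proof.
move=> Tr Ts Tt iT.
pose rep x := odflt x [pick y | `[< T x y >]].
have repT x : T x (rep x).
  by rewrite /rep; case: pickP => [y /asboolP|_].
have repE x y : T x y -> rep x = rep y.
  move=> xy; rewrite /rep (@eq_pick _ _ (fun z => `[< T y z >])).
    by case: pickP => [//|/(_ y)/asboolP[]].
  by move=> z; apply/asboolP/asboolP; apply: Tt => //; exact: Ts.
have repK x : rep (rep x) == rep x by apply/eqP/esym/repE/repT.
pose C := {x : A | rep x == x}.
pose opC : interpretation S C := fun o v =>
  exist (fun x => rep x == x) _ (repK (interp A o (map_tuple val v))).
have C0 : 0 < #|{: C}|.
  have /card_gt0P[x _] := carrier_gt0 A; apply/card_gt0P.
  by exists (exist (fun x => rep x == x) _ (repK x)).
pose Q := Algebra opC C0.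
pose f (x : A) : Q := exist (fun x => rep x == x) _ (repK x).
have fE x y : f x = f y <-> T x y.
  split=> [/(congr1 val) /= xy|/repE xy]; last exact: val_inj.
  by apply: Tt (repT x) _; rewrite xy; apply: Ts.
exists Q, f; split=> //.
- apply: alg_hom => o u; apply: val_inj => /=; apply: repE.
  rewrite map_mktuple; apply: iT => j /=; exact: repT.
- by move=> q; exists (val q); apply: val_inj; apply/eqP; exact: (valP q).
case=> x [y [xy nxy]]; rewrite card_sig.
have [|yx] := boolP (rep y == y); last first.
  by rewrite -[X in _ < X](cardC [pred x | rep x == x])
    -{1}[#|_|]addn0 ltn_add2l;
    apply/card_gt0P; exists y.
move=> /eqP ry; have rx : rep x != x.
  by apply/eqP => rx; apply: nxy; rewrite -rx -ry; exact: repE.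
by rewrite -[X in _ < X](cardC [pred x | rep x == x]) -{1}[#|_|]addn0 ltn_add2l;
  apply/card_gt0P; exists x.
Qed.

End Algebras.

(** * Linkedness in the pseudovariety and induction on size *)

Lemma connect_mono (T T' : finType) (e : rel T) (e' : rel T') (f : T ->
  T') x y :
  (forall u v, e u v -> e' (f u) (f v)) -> connect e x y ->
    connect e' (f x) (f y).
Proof.
move=> ee' /connectP[p]; elim: p x => /= [|z p IH] x; first by move=> _ ->.
by move=> /andP[xz zp] yE; apply: connect_trans (connect1 (ee' _ _ xz))
  (IH _ zp yE).
Qed.

Section Main.
Variables (S : signature) (V : algebra S -> Prop) (M : algebra S).
Hypotheses (iM : idempotent_alg M) (mM : minimal_taylor M).
Hypothesis VE : forall A, V A <-> HSPfin M A.
Variables (eas esm : edges S).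
Hypothesis hE : edge_axioms V eas esm.

Definition asm (A : algebra S) := asm_edges eas esm (A := A).
Definition linked (A : algebra S) : rel A :=
  connect (fun u v => asm u v || asm v u).

Lemma V_sub A (B : subalgebra A) : V A -> V (sub_alg B).
Proof. by move=> /VE VA; apply/VE; exact: HSP_sub. Qed.

Lemma linked_sym (A : algebra S) (x y : A) : linked x y -> linked y x.
Proof.
rewrite /linked => xy; rewrite (@sym_connect_sym _ _ _) //.
by move=> u v; rewrite orbC.
Qed.

Lemma asm_hom (A B : algebra S) (f : A -> B) : V A -> V B -> homomorphism f ->
  forall x y, asm x y -> asm (f x) (f y).
Proof.
move=> VA VB hf x y /orP[] xy; apply/orP.
  by left; exact: (hom1_as hE VA VB hf).
by right; exact: (hom1_sm hE VA VB hf).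
Qed.

Lemma linked_hom (A B : algebra S) (f : A -> B) : V A -> V B ->
  homomorphism f ->
  forall x y, linked x y -> linked (f x) (f y).
Proof.
move=> VA VB hf x y; apply: connect_mono => u v /orP[] uv; apply/orP.
  by left; exact: (asm_hom VA VB hf).
by right; exact: (asm_hom VA VB hf).
Qed.

(** A generator with fewest generated elements supplies the target required by the second
    homomorphism axiom. *)
Lemma minimal_generator (A B : algebra S) (f : A -> B) (a b : A) :
  exists b', f b' = f b /\ Sg_minimal f a b b'.
Proof.
pose g c := [set x | `[< Sg [set a; c] x >]].
have gP c x : x \in g c <-> Sg [set a; c] x.
  by rewrite inE; split=> [/asboolP|xg]; last exact/asboolP.
case: (@arg_minnP A b (fun c => f c == f b) (fun c => #|g c|))
  => [//|c /eqP fc cmin].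
exists c; split=> // c' fc' sub x /gP xc.
have sub' : g c' \subset g c by apply/subsetP => y /gP/sub/gP.
have := cmin c'; rewrite fc' eqxx => /(_ isT) le.
have /setP gE : g c' = g c by apply/eqP; rewrite eqEcard sub' le.
by apply/gP; rewrite gE.
Qed.

Lemma asm_lift (A B : algebra S) (f : A -> B) : V A -> V B -> homomorphism f ->
  forall a b, asm (f a) (f b) -> exists b', f b' = f b /\ asm a b'.
Proof.
move=> VA VB hf a b ab; have [b' [fb' mb']] := minimal_generator f a b.
exists b'; split=> //; apply/orP; case/orP: ab => ab.
  by left; exact: (hom2_as hE VA VB hf ab).
by right; exact: (hom2_sm hE VA VB hf ab).
Qed.

Lemma asm_semilattice (A : algebra S) (x y : A) (t : term S bool) : V A ->
  tev (alg_ops A) (v2 x y) t = y -> tev (alg_ops A) (v2 y x) t = y -> asm x y.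
Proof.
move=> VA xy yx; have iA : idem (alg_ops A) by apply: HSP_idem iM _; apply/VE.
pose s : term S 'I_2 := tsub (fun c : bool => Var (if c then ord0 else
  ord_max)) t.
pose op : operation A 2 := fun v => tev (alg_ops A) (tnth v) s.
have opE u v : op [tuple u; v] = tev (alg_ops A) (v2 u v) t.
  by rewrite /op tev_sub; congr (tev _ _ _); apply: funext; case.
have op_xx u : op [tuple u; u] = u.
  by rewrite opE (_ : v2 u u = fun=> u) ?tev_idem //; apply: funext; case.
have op_xy : op [tuple x; y] = y by rewrite opE.
have op_yx : op [tuple y; x] = y by rewrite opE.
suff : strong_edges eas esm x y by case/andP => xy' _; apply/orP; left.
apply: (base3 hE VA (t := op)).
- by exists s => v; rewrite evalE.
- split.
  + move=> u v /set2P[]-> /set2P[]->;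
      by rewrite ?op_xx ?op_xy ?op_yx !inE eqxx ?orbT.
  + by move=> u _; exact: op_xx.
  + by move=> u v /set2P[]-> /set2P[]->; rewrite ?op_xx ?op_xy ?op_yx.
  + by move=> u v w /set2P[]-> /set2P[]-> /set2P[]->;
      rewrite ?op_xx ?op_xy ?op_yx ?op_xx ?op_xy ?op_yx.
split; first by rewrite !inE eqxx orbT.
by move=> u /set2P[]->; rewrite ?op_xx ?op_xy ?op_yx.
Qed.

Section Minimal.
Variable A : algebra S.
Hypothesis VA : V A.
Hypothesis IH : forall B : algebra S, #|B| < #|A| -> V B ->
  forall x y : B, linked x y.

(** A proper subuniverse is a smaller algebra, hence connected, and the inclusion preserves
    edges. *)
Lemma linked_generate (x y : A) : ~ linked x y -> forall P : A -> Prop,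
  inv1 (alg_ops A) P -> P x -> P y -> forall z, P z.
Proof.
move=> nxy P iP Px Py z; apply: contrapT => nPz; apply: nxy.
pose B := [set u | `[< P u >]].
have BE u : u \in B <-> P u by rewrite inE; split=> /asboolP.
have cB : subuniverse B.
  by apply: inv1_subuniverse => o u uB; apply/BE/iP => j; apply/BE.
have B0 : B != set0 by apply/set0Pn; exists x; apply/BE.
pose Q := Subalgebra cB B0.
have xQ : x \in sub_set Q by apply/BE.
have yQ : y \in sub_set Q by apply/BE.
have small : #|sub_alg Q| < #|A|.
  rewrite card_sig; apply: (@leq_ltn_trans #|predC1 z|).
    apply: subset_leq_card; apply/subsetP => u; rewrite !inE => uQ.
    by apply/eqP => uz; apply: nPz; rewrite -uz; exact/asboolP.
  by rewrite cardC1 ltn_predL; exact: carrier_gt0.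
exact: (linked_hom (V_sub Q VA) VA (@sub_val_hom _ _ Q)
  (IH small (V_sub Q VA) (exist _ x xQ) (exist _ y yQ))).
Qed.

(** For a proper nontrivial congruence, the quotient is connected by induction and its edges lift.
    Each class lies in one component: two unlinked elements of a class would generate the whole
    algebra inside it. *)
Lemma linked_simple (T : A -> A -> Prop) :
  (exists x y, ~ linked (A := A) x y) ->
  (forall x, T x x) -> (forall x y, T x y -> T y x) ->
  (forall x y z, T x y -> T y z -> T x z) -> inv2 (alg_ops A) (alg_ops A) T ->
  (forall x y, T x y -> x = y) \/ (forall x y, T x y).
Proof.
move=> [x0 [y0 nxy0]] Tr Ts Tt iT; apply: contrapT => /not_orP[nT fT].
have [Q [f [hf f_onto fE small]]] := quotient_exists Tr Ts Tt iT.
have iA : idem (alg_ops A) by apply: HSP_idem iM _; apply/VE.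
have VQ : V Q by apply/VE; apply: HSP_quotient hf f_onto; apply/VE.
have {}small : #|Q| < #|A|.
  apply: small; apply: contrapT => nxy; apply: nT => x y xy.
  by apply: contrapT => xny; apply: nxy; exists x, y.
have same x y : f x = f y -> linked x y.
  move=> /fE xy; apply: contrapT => nxy; apply: fT => u v.
  have xT : forall z, T x z by apply: (linked_generate nxy (inv2_section iA
    iT)).
  by apply: Tt (Ts _ _ (xT u)) (xT v).
have step x y : asm (f x) (f y) || asm (f y) (f x) -> linked x y.
  case/orP => /(asm_lift VA VQ hf)[z [fz xz]].
    by apply: connect_trans (same _ _ fz); apply: connect1; rewrite xz.
  apply: (connect_trans (same _ _ (esym fz))).
  by apply: connect1; rewrite xz orbT.
apply: nxy0; have /connectP[p] := IH small VQ (f x0) (f y0).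
elim: p (x0) => [|q p IHp] x /=; first by move=> _ /esym/same.
have [z <-] := f_onto q; move=> /andP[/step xz zp] yE.
by apply: connect_trans xz (IHp _ zp yE).
Qed.

Lemma linked_split : (exists x y : A, ~ linked x y) ->
  split_algebra (alg_ops A) (fun x y => linked x y).
Proof.
move=> nlinked; split=> //.
- by apply: HSP_idem iM _; apply/VE.
- by move=> x; exact: connect0.
- by move=> x y; exact: linked_sym.
- by move=> x y z; exact: connect_trans.
- exact: linked_generate.
- by move=> T; exact: linked_simple.
- by move=> f /alg_hom hf; exact: linked_hom.
- by move=> x y t xy yx; apply: connect1; rewrite (asm_semilattice VA xy yx).
Qed.

Lemma affine_or_majority : (exists x y : A, ~ linked x y) ->
  affine A \/ has_majority_term A.
Proof.
move=> nlinked; have H := linked_split nlinked.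
have MA : HSPfin M A by exact/VE.
have iK := idempotent_idem iM.
have maj (t : term S 'I_3) : (forall x y, [/\ tev (alg_ops A) (v3 x x y) t = x,
    tev (alg_ops A) (v3 x y x) t = x & tev (alg_ops A) (v3 y x x) t = x]) ->
    has_majority_term A.
  move=> tP; exists (fun v => tev (alg_ops A) (tnth v) t) => //.
  by exists t => v; rewrite evalE.
have [n0 [t0 T0]] : exists n (t : term S 'I_n),
  taylor_op (term_fun (alg_ops M) t).
  case: mM => -[n [f [[t ft] Tf]]] _; exists n, t.
  rewrite (_ : term_fun _ _ = f) //; apply: funext => v.
  by rewrite ft evalE.
have [full|nfull] := pselect (full_orders (alg_ops A)
  (fun x y => linked x y)); last first.
  right; have [a [b [R [ab [iR Raa Rbb Rab Rba]]]]] : exists a b R,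
    ~ linked a b /\
      [/\ inv2 (alg_ops A) (alg_ops A) R, R a a, R b b, R a b & ~ R b a].
    apply: contrapT => nR; apply: nfull => a b R ab iR Raa Rbb Rab.
    by apply: contrapT => nba; apply: nR; exists a, b, R.
  have Aab := order_or_full H ab iR Raa Rbb Rab Rba.
  have [[t /maj//]|proj] := two_element H ab Aab iR Raa Rbb Rab Rba.
  have [i ti] := proj _ t0.
  case: (@projection_nonTaylor _ _ _ (alg_ops M) (alg_ops A) _ t0 i (fun=> True)
    (fun x => x == a)) => //.
  - by move=> m e1 e2; exact: HSP_identity.
  - exists a, b; split=> //; rewrite eqxx => /esym/eqP ba.
    by apply: ab; rewrite ba; exact: connect0.
  - by move=> v _; rewrite ti.
have [[f Lf]|nL] := pselect (exists f, latin (alg_ops A) f).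
  left; have [add [z [opp G]]] := latin_group H full Lf.
  have [d dP] := maltsev_term H full G.
  have [R [c cP]] := polynomial_clone_affine G (split_idem H) dP.
  exists R, c => n f' _; rewrite -cP.
  by split=> -[t tE]; exists t => v; rewrite tE; [|symmetry]; exact: evalE.
right; have {}nL f : ~ latin (alg_ops A) f by exact: contra_ex nL f.
have [a [b ab]] := nlinked.
have [t majt] := local_majority H full nL ab.
have [n [u [Du Tu]]] := preserving_taylor H full nL iK ab majt T0.
have iJ := split_idem H.
have uP : term_op (interp M) (term_fun (alg_ops M) u).
  by exists u => v; rewrite evalE.
have clone := mM.2 n _ uP Tu.
(* By minimality of the clone of [M], every basic operation is a term in [u], so [{a, b}] is a
   subuniverse; [a] and [b] generate the algebra. *)
have Aab : forall x, x = a \/ x = b.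
  apply: (split_gen H ab); [move=> o w wab | by left | by right].
  (* [same_clone] speaks of positive arities only; at arity zero, idempotence forces the value
     [a]. *)
  have [o0|o_gt0] := posnP (arity o).
    rewrite (_ : w = fun=> a); first by left; exact: iJ.
    by apply: funext => j; have := ltn_ord j; rewrite {2}o0.
  have [_ [|e eE]] := clone _ (interp M o) o_gt0.
    exists (App (fun i => Var i)) => v; rewrite evalE /= /alg_ops.
    by rewrite mktuple_tnth.
  have De : preserves (alg_ops A) a b (expand u e).
    elim: {eE} e => [x|o' es IHe]; first exact: preserves_var.
    exact: preserves_sub.
  have <- : tev (alg_ops A) w (expand u e) = alg_ops A o w.
    symmetry; apply: (HSP_identity (t1 := App (fun i => Var i)) MA) => v.
    by rewrite -eval_expand -[v in RHS]tnth_mktuple_fun -eE.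
  exact: De.
by apply: (maj t); exact: (majority_pair H ab Aab majt).
Qed.

End Minimal.

Lemma asm_weakly_connected (A : algebra S) : V A -> forall x y : A, linked x y.
Proof.
have [n] := ubnP #|A|; elim: n A => // n IH A le_n VA x y.
apply: contrapT => nxy.
(* The base axioms speak of subalgebras, so the argument runs on the algebra viewed as a subalgebra
   of itself. *)
have AT : subuniverse [set: A] by move=> o v _; rewrite inE.
have A0 : [set: A] != set0 by apply/set0Pn; exists x.
pose T := Subalgebra AT A0.
have VT : V (sub_alg T) by exact: V_sub.
have xT z : z \in sub_set T by rewrite inE.
have nT : exists x y : sub_alg T, ~ linked x y.
  exists (exist _ x (xT x)), (exist _ y (xT y)) => xy; apply: nxy.
  exact: (linked_hom VT VA (@sub_val_hom _ _ T) xy).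
have [|aT|mT] := affine_or_majority VT _ nT.
- move=> B ltB; apply: IH; rewrite -ltnS; apply: leq_trans le_n.
  by apply: leq_trans ltB _; rewrite card_sig max_card.
- apply: nxy; apply: connect1; rewrite /asm /asm_edges.
  by rewrite (base1 hE VA VT aT (xT x) (xT y)).
- apply: nxy; apply: connect1; rewrite /asm /asm_edges.
  by rewrite (base2 hE VA VT mT (xT x) (xT y)) orbT.
Qed.

End Main.

Unset Implicit Arguments.

Theorem theorem33 (S : signature) (V : algebra S -> Prop)
  (hV : fg_minimal_taylor_pseudovariety V)
  (eas esm : edges S) (hE : edge_axioms V eas esm)
  (A : algebra S) (hA : V A) :
  weakly_connected (asm_edges eas esm (A := A)).
Proof.
case: hV => M [iM mM VE].
exact: (asm_weakly_connected iM mM VE hE hA).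
Qed.
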